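(* There exists an infinite sequence of positive integers $\{n_i\}_{i\in\mathbb{N}}$, with $n_i\to\infty$, such that $$ \min_{\omega_{n_i}\subset\mathbb{S}^3}E_0(\omega_{n_i}) \leq -\frac{n_i^2}{4} -\frac{1}{3}n_i\log n_i +C_S\, n_i +o(n_i)\qquad (i\to\infty), $$ where the minimum is over all sets $\omega_{n_i}$ of $n_i$ points of $\mathbb{S}^3$ and $$ C_S=\frac{1}{3}\left(2+\log\frac{9\pi}{64}\right). $$
   Context: For $\omega_N=\{x_1,\dots,x_N\}\subset\mathbb{S}^3\subset\mathbb{R}^4$, the logarithmic energy is $E_0(\omega_N)=\sum_{i\neq j}\log\frac{1}{\|x_i-x_j\|}$, the sum being over ordered pairs $(i,j)$, $1\le i,j\le N$, $i\ne j$, with $\|\cdot\|$ the Euclidean norm. *)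

(* Defs.v *)
From mathcomp Require Import all_boot all_order all_algebra.
From mathcomp Require Import all_classical all_reals all_analysis.

Set Implicit Arguments.
Unset Strict Implicit.
Unset Printing Implicit Defensive.

Import Order.TTheory GRing.Theory Num.Theory.
Import numFieldNormedType.Exports.

Local Open Scope classical_set_scope.
Local Open Scope ring_scope.

(* The norm `|u| that the library puts on row vectors is the sup norm. *)
Definition enorm (R : realType) (d : nat) (u : 'rV[R]_d) : R :=
  Num.sqrt (\sum_(k < d) u 0 k ^+ 2).

Definition sphere3 (R : realType) : set 'rV[R]_4 := [set u | enorm u = 1].

(* A set of N points is given by an injective enumeration of it.  Injectivity
   cannot be dropped: 0^-1 = 0 and ln 0 = 0, so that a repeated point would
   contribute 0, not +oo, to the energy. *)
Definition sphere_config (R : realType) (N : nat) : set ('I_N -> 'rV[R]_4) :=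
  [set x | injective x /\ forall i, sphere3 (x i)].

Definition log_energy (R : realType) (N : nat) (x : 'I_N -> 'rV[R]_4) : R :=
  \sum_(i < N) \sum_(j < N | i != j) ln (1 / enorm (x i - x j)).

Definition is_min_log_energy (R : realType) (N : nat) (m : R) : Prop :=
  let energies := @log_energy R N @` @sphere_config R N in
  energies m /\ lbound energies m.

Definition C_S (R : realType) : R := 1 / 3 * (2 + ln (9 * pi / 64)).

(* Main.v *)
Require Import Defs.
From HB Require Import structures.
From mathcomp Require Import all_boot all_order all_algebra.
From mathcomp Require Import all_classical all_reals all_analysis.
From mathcomp Require Import perm lra.

Import Order.TTheory GRing.Theory Num.Theory.
Import numFieldNormedType.Exports.

(** Identify [S^3] with the unit sphere of [C^2] and place [r] equally spaced points on each
    of [m] Hopf fibres, [n = m r].  Averaging over independent rotations of the fibres (a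
    product over roots of unity) bounds the energy by
      [- n ln r - r^2 / 2 * \sum_(i != j) ln (1 + sqrt (1 - v_ij))],
    where [v_ij] is the squared modulus of the Hermitian product of representatives of the
    fibres [i] and [j].  The fibres are sampled from the spherical ensemble, the determinantal
    process of the monomials [z^k w^(m-1-k)], whose two-point function is
    [m^2 (1 - v^(m-1))].  Since [v] is uniform on [[0, 1]] for independent fibres, the
    expectation of [\sum_(i != j) v_ij^t] is [m^2 (1 / (t + 1) - 1 / (t + m))], and expanding
    the logarithm in powers of [v] gives the mean energy
      [- n^2 / 4 - n ln r + r^2 / (4 c_m)], with [c_m = 'C(2m, m) / 4^m ~ (pi m)^(-1/2)].
    The choice [r ~ 8 / (3 sqrt pi) * sqrt m] yields the constant [C_S].  To keep every
    expectation a finite sum, the process is sampled on a fine grid of fibres and the phases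
    among roots of unity of large order; only polynomials in [v] are averaged. *)

Set Implicit Arguments.
Unset Strict Implicit.
Unset Printing Implicit Defensive.

Local Open Scope classical_set_scope.
Local Open Scope ring_scope.

(** * The binomial series of [(1 - v)^(-1/2)] *)

(** With [n = m r] and [r = rho sqrt m] one has [ln r = (1/3) ln n + (2/3) ln rho], so the energy
    inside the fibres alone yields [- (1/3) n ln n]; the interaction between fibres must then stay
    within [O(n)] of [- n^2 / 4]. Independent uniform fibres fail here: the missing diagonal pairs
    leave an excess [n r / 4], which would force [r] to stay bounded. The repulsion of the
    determinantal process lowers this excess to about [n rho sqrt pi / 4].

    All randomness is a first-moment argument on a finite set. Approximations enter at three places:
    the truncation order of the series, the fineness of the grid and the order of the roots of
    unity. Each is fixed after [m] and [r], with an error as small as wished; together they cost a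
    constant and never interfere with the asymptotics in [n]. *)

Lemma derive_ge0_le (R : realType) (f df : R -> R) (a b : R) : a <= b ->
  (forall x, x \in `[a, b] -> is_derive x 1 f (df x)) ->
  (forall x, x \in `]a, b[ -> 0 <= df x) -> f a <= f b.
Proof.
move=> ab fdf df0; have [->//|neq_ab] := eqVneq a b.
have ltab : a < b by rewrite lt_neqAle neq_ab.
have Dx x : x \in `]a, b[ -> is_derive x 1 f (df x).
  by move=> xab; apply: fdf; exact: subset_itv_oo_cc xab.
have fc : {within `[a, b], continuous f}.
  apply: derivable_within_continuous => x /fdf fx.
  exact: (@ex_derive _ _ _ _ _ _ _ fx).
have [c /df0 df_c fab] := MVT ltab Dx fc.
by rewrite -subr_ge0 fab mulr_ge0 // subr_ge0.
Qed.

(* ['C(2k, k) / 4^k], the coefficient of [v^k] in [(1 - v)^(-1/2)]. *)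
Definition central_binom_ratio (R : realType) (k : nat) : R :=
  \prod_(j < k) ((j.*2.+1)%:R / (j.*2.+2)%:R).

Local Notation cbr := (@central_binom_ratio _).

Lemma cbr0 (R : realType) : cbr 0 = 1 :> R.
Proof. by rewrite /central_binom_ratio big_ord0. Qed.

Lemma cbrS (R : realType) k : cbr k.+1 = cbr k * (k.*2.+1)%:R / (k.*2.+2)%:R :> R.
Proof. by rewrite /central_binom_ratio big_ord_recr /= mulrA. Qed.

Lemma natr_double (R : realType) k : (k.*2)%:R = 2 * k%:R :> R.
Proof. by rewrite -mul2n natrM. Qed.

Lemma cbrSE (R : realType) k : (k.+1)%:R * cbr k.+1 = (k%:R + 1 / 2) * cbr k :> R.
Proof.
rewrite cbrS -doubleS !natr_double invfM [(k.*2.+1)%:R]mulrSr natr_double.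
have z0 : k.+1%:R != 0 :> R by rewrite pnatr_eq0.
have := mulfV z0; set w := _^-1 => zw.
transitivity ((k.+1%:R * w) * ((k%:R + 1 / 2) * cbr k)); first by lra.
by rewrite zw [LHS]mul1r.
Qed.

Lemma cbr_gt0 (R : realType) k : 0 < cbr k :> R.
Proof. by apply: prodr_gt0 => i _; rewrite divr_gt0. Qed.

(** The left-hand side decreases from 1 because [(2k + 3) (2k + 1) <= (2k + 2)^2]. It serves to make
    [cbr k] arbitrarily small. *)
Lemma cbr_sqr_le (R : realType) k : (k.*2.+1)%:R * cbr k ^+ 2 <= 1 :> R.
Proof.
elim: k => [|k IHk]; first by rewrite cbr0 expr1n mulr1.
apply: le_trans IHk; rewrite cbrS.
have k0 : 0 <= k%:R :> R by [].
rewrite doubleS !mulrSr !natr_double.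
set x := k%:R in k0 *; set c := cbr k.
have -> : (2 * x + 1 + 1 + 1) * (c * (2 * x + 1) / (2 * x + 1 + 1)) ^+ 2 =
  ((2 * x + 1) * c ^+ 2) * ((2 * x + 3) * (2 * x + 1) / (2 * x + 1 + 1) ^+ 2).
  by rewrite -exprVn; lra.
apply: ler_piMr; first by rewrite mulr_ge0 ?sqr_ge0 //; lra.
by rewrite ler_pdivrMr ?exprn_gt0; nra.
Qed.

(* A truncation of [y (1 - v)^(-1/2) = 1], where [v = 1 - y^2]; being increasing in [y]
   with value 1 at [y = 1], it stays below 1. *)
Definition smoothstep (R : realType) (K : nat) (y : R) : R :=
  y * \sum_(k < K.+1) cbr k * (1 - y ^+ 2) ^+ k.

Lemma is_derive_1Bsqr_exp (R : realType) k (y : R) :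
  is_derive y 1 (fun x : R => (1 - x ^+ 2) ^+ k) (- (k%:R * 2 * y * (1 - y ^+ 2) ^+ k.-1)).
Proof.
have -> : (fun x : R => (1 - x ^+ 2) ^+ k) = (cst 1 - (id : R -> R) ^+ 2) ^+ k.
  by apply/funext => x; rewrite !exprfctE /= !fctE.
apply: is_derive_eq; rewrite /GRing.scale /= !fctE /=; lra.
Qed.

(** By [cbrSE] the derivatives of the summands telescope, leaving one term whose sign is evident on
    [[0, 1]]. *)
Lemma is_derive_smoothstep (R : realType) K (y : R) :
  is_derive y 1 (smoothstep K)
    ((K.*2.+1)%:R * cbr K * (1 - y ^+ 2) ^+ K).
Proof.
elim: K => [|K IHK].
  rewrite /smoothstep cbr0 expr0 !mulr1.
  under eq_fun do rewrite big_ord1 expr0 cbr0 !mulr1.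
  exact: is_derive_id.
have -> : smoothstep K.+1 =
    smoothstep K + cst (cbr K.+1) * ((id : R -> R) * (fun x : R => (1 - x ^+ 2) ^+ K.+1)).
  apply/funext => x; rewrite /smoothstep !fctE /= big_ord_recr /=; lra.
have D := is_derive_1Bsqr_exp K.+1 y.
have {}D := is_deriveM (is_derive_cst (cbr K.+1) y 1) (is_deriveM (is_derive_id y 1) D).
apply: (is_derive_eq (is_deriveD IHK D)).
rewrite /GRing.scale /=.
have E := @cbrSE R K.
have -> : (K.*2.+1)%:R * cbr K = 2 * (K.+1%:R * cbr K.+1) :> R.
  by rewrite E mulrSr natr_double; lra.
rewrite mulr0 [_ ^+ K.+1]exprS doubleS !mulrSr natr_double /=; lra.
Qed.

Lemma smoothstep_le1 (R : realType) K (y : R) : 0 <= y <= 1 -> smoothstep K y <= 1.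
Proof.
case/andP=> y0 y1.
have -> : 1 = smoothstep K (1 : R).
  rewrite /smoothstep big_ord_recl /= cbr0 !expr0 !mul1r big1 ?addr0 ?mulr1 // => i _.
  by rewrite expr1n subrr expr0n /= mulr0.
apply: (derive_ge0_le y1) => x xi; first exact: is_derive_smoothstep.
rewrite mulr_ge0 ?(mulr_ge0 _ (ltW (cbr_gt0 _ _))) // exprn_ge0 // subr_ge0.
move: xi; rewrite in_itv /= => /andP[yx x1].
by rewrite expr_le1 ?(ltW x1) // ltW // (le_lt_trans y0).
Qed.

(* The series of [- ln (1 + sqrt (1 - v))] truncated and shifted so as to be exact at
   [v = 1]: the truncation is then an upper bound, and the shift cancels in
   [sum_cbr_energy_le], so that the sum [ln 2] of the series is never needed. *)
Lemma ln_1D_ge (R : realType) K (y : R) : 0 <= y <= 1 ->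
  - ln (1 + y) <= \sum_(k < K) cbr k.+1 / (2 * k.+1%:R) * ((1 - y ^+ 2) ^+ k.+1 - 1).
Proof.
case/andP=> y0 y1.
pose f (x : R) := ln (1 + x) + \sum_(k < K) cbr k.+1 / (2 * k.+1%:R) *
   ((1 - x ^+ 2) ^+ k.+1 - 1).
pose df (x : R) := (1 + x)^-1 - x * \sum_(k < K) cbr k.+1 * (1 - x ^+ 2) ^+ k.
(* The shift by [- 1] makes every summand vanish at 0, so [f 0 = 0]. *)
suff : f 0 <= f y.
  rewrite /f addr0 ln1 add0r big1; last by move=> i _; rewrite expr0n subr0 expr1n subrr mulr0.
  by rewrite -subr_ge0 subr0 => ?; lra.
apply: (@derive_ge0_le _ f df _ _ y0) => x; rewrite in_itv /= => /andP[x0 xy].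
  have x10 : 0 < 1 + x by lra.
  have D1 : is_derive x 1 (fun x : R => ln (1 + x)) (1 + x)^-1.
    have D0 : is_derive x 1 (cst 1 + (id : R -> R)) (0 + 1) by exact: is_deriveD.
    have D1 : is_derive ((cst 1 + (id : R -> R)) x) 1 (@ln R) (1 + x)^-1 by exact: is_derive1_ln.
    by have := is_derive1_comp D1 D0; rewrite add0r mulr1.
  have D2 : is_derive x 1 (\sum_(k < K) (cst (cbr k.+1 / (2 * k.+1%:R)) *
        ((fun x : R => (1 - x ^+ 2) ^+ k.+1) - cst 1)))
     (\sum_(k < K) (- (x * (cbr k.+1 * (1 - x ^+ 2) ^+ k)))).
    apply: is_derive_sum => k; have D := is_derive_1Bsqr_exp k.+1 x.
    have D3 := is_deriveM (is_derive_cst (cbr k.+1 / (2 * k.+1%:R)) x 1)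
      (is_deriveB D (is_derive_cst (1 : R) x 1)).
    apply: (is_derive_eq D3).
    rewrite /GRing.scale /=.
    have k0 : k.+1%:R != 0 :> R by rewrite pnatr_eq0.
    rewrite invfM; set z := k.+1%:R in k0 *; have := mulVf k0.
    set w := z^-1 => wz.
    transitivity ((w * z) * (- (x * (cbr k.+1 * (1 - x ^+ 2) ^+ k)))); first by lra.
    by rewrite wz mul1r.
  have -> : f = (fun x : R => ln (1 + x)) + \sum_(k < K) (cst (cbr k.+1 / (2 * k.+1%:R)) *
        ((fun x : R => (1 - x ^+ 2) ^+ k.+1) - cst 1)).
    by apply/funext => z; rewrite /f fctE fct_sumE.
  by apply: (is_derive_eq (is_deriveD D1 D2)); rewrite sumrN -mulr_sumr.
(* Multiplied by [(1 - x) (1 + x) = 1 - x^2], the inequality becomes [smoothstep K x <= 1] with the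
   term [k = 0] moved to the other side. *)
rewrite /df subr_ge0.
have x1 : 0 < 1 - x by lra.
have S := @smoothstep_le1 R K x; rewrite ltW //= in S.
have {}S := S (ltW (lt_le_trans xy y1)).
rewrite -(ler_pM2r x1) -(@ler_pM2r _ (1 + x)); last by lra.
rewrite [leRHS]mulrAC mulVf ?mul1r; last by rewrite gt_eqF //; lra.
move: S; rewrite /smoothstep big_ord_recl /= cbr0 expr0 mulr1 => S.
suff : x * (\sum_(k < K) cbr k.+1 * (1 - x ^+ 2) ^+ k) * (1 - x) * (1 + x) =
  x * (\sum_(k < K) cbr (lift ord0 k) * (1 - x ^+ 2) ^+ (lift ord0 k)).
  by move=> ->; lra.
rewrite -!mulrA; congr (_ * _); rewrite mulr_suml; apply: eq_bigr => k _.
by rewrite lift0 [_ ^+ k.+1]exprS; lra.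
Qed.

(** Termwise integration of the series, whose full integral over [[0, 1]] is 2. The sum telescopes,
    as [c_k / (k + 1) = 2 (c_k - c_(k+1))]. *)
Lemma sum_cbr_div1 (R : realType) K :
  \sum_(k < K) cbr k / (k.+1%:R) = 2 * (1 - cbr K) :> R.
Proof.
elim: K => [|K IHK]; first by rewrite big_ord0 cbr0 subrr mulr0.
have K0 : K.+1%:R != 0 :> R by rewrite pnatr_eq0.
rewrite big_ord_recr /= IHK; apply: (mulfI K0).
have E := @cbrSE R K.
rewrite mulrDr [_ * (_ / _)]mulrC divfK // mulrCA [RHS]mulrCA.
by rewrite !mulrBr mulr1 E; move: (cbr K) => c; lra.
Qed.

(** Truncated form of [(m + 1/2) B(m + 1, 1/2) = m B(m, 1/2)]; the boundary term has the sign that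
    lets it be dropped in an upper bound. *)
Lemma sum_cbr_rec (R : realType) m K : (0 < m)%N ->
  (m%:R + 1 / 2) * \sum_(k < K) cbr k / (k + m.+1)%:R =
  m%:R * \sum_(k < K) cbr k / (k + m)%:R - K%:R * cbr K / (K + m)%:R :> R.
Proof.
move=> m0; elim: K => [|K IHK]; first by rewrite !big_ord0 !mulr0 !mul0r subr0.
rewrite !big_ord_recr /= !mulrDr {}IHK cbrSE.
have n1 : (K + m.+1)%:R != 0 :> R by rewrite pnatr_eq0 addnS.
have n2 : (K + m)%:R != 0 :> R by rewrite pnatr_eq0 addn_eq0 negb_and -!lt0n m0 orbT.
have := mulVf n1; have := mulVf n2; rewrite addSnnS.
set a := (K + m)%:R^-1; set b := (K + m.+1)%:R^-1.
rewrite addnS mulrSr natrD => aE bE.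
suff : (m%:R + 1 / 2 + K%:R + 1 / 2) * b * cbr K = (K%:R + m%:R) * a * cbr K.
  by move: (\sum_(_ < _) _) => S ?; lra.
transitivity ((b * (K%:R + m%:R + 1)) * cbr K); first by lra.
by rewrite bE [_ * a]mulrC aE.
Qed.

(* The full series is the Beta integral B(m, 1/2) = 1 / (m c_m). *)
Lemma sum_cbr_div_le (R : realType) m K : (0 < m)%N ->
  \sum_(k < K) cbr k / (k + m)%:R <= (m%:R * cbr m)^-1 :> R.
Proof.
case: m => // m _; elim: m => [|m IHm].
  under eq_bigr do rewrite addn1.
  rewrite sum_cbr_div1 cbrSE cbr0 add0r !mulr1 mul1r invrK.
  by have := cbr_gt0 R K; lra.
have m12 : 0 < m.+1%:R + 1 / 2 :> R by rewrite addr_gt0 // divr_gt0.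
rewrite cbrSE -(ler_pM2l m12) sum_cbr_rec // invfM mulrA mulfV ?gt_eqF // mul1r.
have := ler_wpM2l (ler0n R m.+1) IHm.
rewrite invfM mulrA mulfV ?pnatr_eq0 // mul1r; apply: le_trans.
by rewrite gerBl divr_ge0 // mulr_ge0 // ltW // cbr_gt0.
Qed.

(** The left-hand side is the mean, over the ensemble, of the bound of [ln_1D_ge] summed over
    ordered pairs of fibres: [m (m - 1)] counts the pairs and comes from the shift. The term in
    [cbr K.+1] is the truncation error. *)
Lemma sum_cbr_energy_le (R : realType) m K : (0 < m)%N ->
  \sum_(k < K) cbr k.+1 / (2 * k.+1%:R) *
     (m%:R ^+ 2 * (k.+2%:R^-1 - (k.+1 + m)%:R^-1) - m%:R * (m%:R - 1))
  <= - (m%:R ^+ 2 / 2) + m%:R ^+ 2 * cbr K.+1 + (2 * cbr m)^-1 :> R.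
Proof.
move=> m0.
(* With [j = k + 1], the bracket equals [j (- m^2 / (j + 1) + m / (j + m))]; the factor [j] cancels
   the denominator of the logarithmic series and leaves the two sums bounded above. *)
have E (k : 'I_K) : cbr k.+1 / (2 * k.+1%:R) *
     (m%:R ^+ 2 * (k.+2%:R^-1 - (k.+1 + m)%:R^-1) - m%:R * (m%:R - 1)) =
   - (m%:R ^+ 2 / 2) * (cbr k.+1 / k.+2%:R) +
   m%:R / 2 * (cbr k.+1 / (k.+1 + m)%:R) :> R.
  have n1 : k.+1%:R != 0 :> R by rewrite pnatr_eq0.
  have n2 : k.+2%:R != 0 :> R by rewrite pnatr_eq0.
  have n3 : (k.+1 + m)%:R != 0 :> R by rewrite pnatr_eq0.
  rewrite invfM; have := mulVf n1; have := mulVf n2; have := mulVf n3.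
  set a := k.+1%:R^-1; set b := k.+2%:R^-1; set c := (k.+1 + m)%:R^-1.
  rewrite natrD (mulrSr _ k.+1); set j := k.+1%:R; set M := m%:R => cE bE aE.
  have -> : M ^+ 2 * (b - c) - M * (M - 1) = j * (- M ^+ 2 * b + M * c).
    suff : M ^+ 2 * (b * (j + 1)) - M * (c * (j + M)) = M ^+ 2 - M by lra.
    by rewrite bE cE; lra.
  transitivity (cbr k.+1 * (a * j) * (- (M ^+ 2) * b + M * c) / 2); first by lra.
  by rewrite aE; lra.
under eq_bigr do rewrite E.
rewrite big_split /= -!mulr_sumr.
have S1 : \sum_(k < K) cbr k.+1 / k.+2%:R = 1 - 2 * cbr K.+1 :> R.
  have := @sum_cbr_div1 R K.+1; rewrite big_ord_recl cbr0.
  under eq_bigr do rewrite lift0.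
  by move: (\sum_(_ < _) _) => S; rewrite divr1; lra.
have S2 : \sum_(k < K) cbr k.+1 / (k.+1 + m)%:R <= (m%:R * cbr m)^-1 :> R.
  apply: le_trans (@sum_cbr_div_le R m K.+1 m0); rewrite big_ord_recl /=.
  by rewrite lerDr divr_ge0 // ltW // cbr_gt0.
have m20 : 0 <= m%:R / 2 :> R by rewrite divr_ge0.
have := ler_wpM2l m20 S2; rewrite invfM mulrACA mulfV ?pnatr_eq0 -?lt0n // mul1r.
by rewrite S1 invfM; move: (\sum_(_ < _) _) => S; lra.
Qed.

(** * Wallis' inequality *)

(** Integration by parts over [[0, pi / 2]], with primitives in place of integrals; the boundary
    term [cos x * sin x ^+ n.+1] vanishes at both ends. *)
Lemma sin_pow_primitive (R : realType) n (F : R -> R) :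
  (forall x : R, is_derive x 1 F (sin x ^+ n)) ->
  exists G : R -> R, (forall x : R, is_derive x 1 G (sin x ^+ n.+2)) /\
    G (pi / 2) - G 0 = n.+1%:R / n.+2%:R * (F (pi / 2) - F 0).
Proof.
move=> DF.
exists (fun x => n.+2%:R^-1 * (n.+1%:R * F x - cos x * sin x ^+ n.+1)); split; last first.
  by rewrite cos_pihalf sin0 expr0n /= !(mul0r, mulr0, subr0) -!mulrBr mulrA [_ / _]mulrC.
move=> x.
have Ds := is_deriveX n.+1 (is_derive_sin x).
have D := is_deriveM (is_derive_cst (n.+2%:R^-1 : R) x 1)
  (is_deriveB (is_deriveM (is_derive_cst (n.+1%:R : R) x 1) (DF x))
    (is_deriveM (is_derive_cos x) Ds)).
have -> : (fun x => n.+2%:R^-1 * (n.+1%:R * F x - cos x * sin x ^+ n.+1)) =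
  cst n.+2%:R^-1 * (cst n.+1%:R * F - cos * (sin : R -> R) ^+ n.+1).
  by apply/funext => y; rewrite !fctE.
apply: (is_derive_eq D); rewrite /GRing.scale /= !fctE /= !mulr0 !addr0.
have n2 : n.+2%:R != 0 :> R by rewrite pnatr_eq0.
apply: (mulfI n2) => /=; rewrite [LHS]mulrA mulfV // mul1r.
have := cos2sin2 x; move: (cos x) (sin x) => c s c2.
rewrite !exprS (mulrSr _ n.+1) (_ : c * (n.+1%:R * s ^+ n * c) = n.+1%:R * s ^+ n * c ^+ 2); last by lra.
by rewrite c2; lra.
Qed.

(** The integrals of [sin^(2m)] and [sin^(2m+1)] over [[0, pi / 2]] are [(pi / 2) c_m] and
    [1 / ((2m + 1) c_m)], and the second is at most the first. *)
Lemma wallis_le (R : realType) m : 2 / pi <= (m.*2.+1)%:R * cbr m ^+ 2 :> R.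
Proof.
have even : exists F : R -> R, (forall x : R, is_derive x 1 F (sin x ^+ m.*2)) /\
    F (pi / 2) - F 0 = pi / 2 * cbr m.
  elim: m => [|m [F [DF EF]]].
    by exists id; split=> [x|]; rewrite ?cbr0 ?mulr1 ?subr0 //; exact: is_derive_id.
  have [G [DG EG]] := sin_pow_primitive DF.
  by exists G; split=> [x|]; rewrite ?doubleS // EG EF cbrS mulrC -!mulrA.
have odd : exists F : R -> R, (forall x : R, is_derive x 1 F (sin x ^+ m.*2.+1)) /\
    F (pi / 2) - F 0 = ((m.*2.+1)%:R * cbr m)^-1.
  elim: m {even} => [|m [F [DF EF]]].
    exists (- cos : R -> R); split=> [x|].
      by apply: (is_derive_eq (is_deriveN (is_derive_cos x))); rewrite opprK.
    by rewrite !fctE cos_pihalf cos0 cbr0 mulr1 invr1; lra.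
  have [G [DG EG]] := sin_pow_primitive DF.
  exists G; split=> [x|]; first by rewrite doubleS.
  rewrite EG EF cbrS doubleS !invfM invrK [LHS]mulrAC [RHS]mulrC; congr (_ * _).
  by rewrite [RHS]mulrC; congr (_ * _); exact: mulrC.
have [F [DF EF]] := even; have [G [DG EG]] := odd.
have pi2 : 0 <= pi / 2 :> R by rewrite divr_ge0 // pi_ge0.
have := @derive_ge0_le R (F - G) (fun x => sin x ^+ m.*2 - sin x ^+ m.*2.+1) 0 (pi / 2) pi2.
have D x : x \in `[0, pi / 2] ->
    is_derive x 1 (F - G) (sin x ^+ m.*2 - sin x ^+ m.*2.+1) by move=> _; exact: is_deriveB.
move=> /(_ D) {}D.
have /D : forall x : R, x \in `]0, (pi / 2)[ -> 0 <= sin x ^+ m.*2 - sin x ^+ m.*2.+1.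
  move=> x; rewrite in_itv /= => xi; rewrite subr_ge0 exprS.
  by rewrite ler_piMl ?sin_le1 // exprn_ge0 // ltW // sin_gt0_pihalf.
rewrite !fctE => FG.
have {FG} : ((m.*2.+1)%:R * cbr m)^-1 <= pi / 2 * cbr m :> R by rewrite -EF -EG; lra.
have c0 : 0 < (m.*2.+1)%:R * cbr m :> R by rewrite mulr_gt0 ?cbr_gt0.
rewrite -(ler_pM2l c0) mulfV ?gt_eqF // => H.
rewrite ler_pdivrMr ?pi_gt0 //.
by rewrite -(ler_pM2r (_ : 0 < 1 / 2 :> R)) ?divr_gt0 //; lra.
Qed.

(** * Complex numbers *)

Record cplx (R : Type) : Type := Cplx { cre : R; cim : R }.

Section CplxChoice.
Variable R : choiceType.

Definition pair_of_cplx (z : cplx R) : R * R := (cre z, cim z).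
Definition cplx_of_pair (p : R * R) : cplx R := Cplx p.1 p.2.

Lemma pair_of_cplxK : cancel pair_of_cplx cplx_of_pair.
Proof. by case. Qed.

HB.instance Definition _ := Choice.copy (cplx R) (can_type pair_of_cplxK).

End CplxChoice.

Section CplxField.
Variable R : realFieldType.
Implicit Types x y z : cplx R.

Definition cadd x y := Cplx (cre x + cre y) (cim x + cim y).
Definition copp x := Cplx (- cre x) (- cim x).
Definition cmul x y :=
  Cplx (cre x * cre y - cim x * cim y) (cre x * cim y + cim x * cre y).
Definition nsq x := cre x ^+ 2 + cim x ^+ 2.
Definition cinv x := Cplx (cre x / nsq x) (- cim x / nsq x).

Lemma caddA : associative cadd.
Proof. by move=> x y z; rewrite /cadd /= !addrA. Qed.

Lemma caddC : commutative cadd.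
Proof. by move=> x y; rewrite /cadd addrC [cim x + _]addrC. Qed.

Lemma cadd0 : left_id (Cplx 0 0) cadd.
Proof. by case=> a b; rewrite /cadd /= !add0r. Qed.

Lemma caddN : left_inverse (Cplx 0 0) copp cadd.
Proof. by case=> a b; rewrite /cadd /= !addNr. Qed.

HB.instance Definition _ := GRing.isZmodule.Build (cplx R) caddA caddC cadd0 caddN.

Lemma cmulA : associative cmul.
Proof. by move=> x y z; rewrite /cmul /=; congr Cplx; lra. Qed.

Lemma cmulC : commutative cmul.
Proof. by move=> x y; rewrite /cmul /=; congr Cplx; lra. Qed.

Lemma cmul1 : left_id (Cplx 1 0) cmul.
Proof. by case=> a b; rewrite /cmul /=; congr Cplx; lra. Qed.

Lemma cmulDl : left_distributive cmul cadd.
Proof. by move=> x y z; rewrite /cmul /=; congr Cplx; rewrite /=; lra. Qed.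

Lemma cone_neq0 : Cplx 1 0 != 0 :> cplx R.
Proof. by apply/eqP => -[] /eqP; rewrite oner_eq0. Qed.

HB.instance Definition _ :=
  GRing.Zmodule_isComNzRing.Build (cplx R) cmulA cmulC cmul1 cmulDl cone_neq0.

Lemma nsq_ge0 x : 0 <= nsq x.
Proof. by rewrite addr_ge0 ?sqr_ge0. Qed.

Lemma nsq_eq0 x : (nsq x == 0) = (x == 0).
Proof.
rewrite paddr_eq0 ?sqr_ge0 // !sqrf_eq0; case: x => a b /=.
by apply/andP/eqP => [[/eqP-> /eqP->] //|[-> ->]].
Qed.

Lemma cmulV x : x != 0 -> cmul (cinv x) x = 1.
Proof.
move=> x0; have n0 : nsq x != 0 by rewrite nsq_eq0.
have := mulVf n0; rewrite /cmul /cinv /= {2}/nsq; set w := (nsq x)^-1 => E.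
by congr Cplx; lra.
Qed.

Lemma cinv0 : cinv 0 = 0.
Proof. by rewrite /cinv /= mul0r oppr0 mul0r. Qed.

HB.instance Definition _ := GRing.ComNzRing_isField.Build (cplx R) cmulV cinv0.

Definition conjc x := Cplx (cre x) (- cim x).

Lemma conjc_is_zmod_morphism : zmod_morphism conjc.
Proof. by move=> x y; rewrite /conjc /=; congr Cplx; rewrite /= ?opprD ?opprK. Qed.

Lemma conjc_is_monoid_morphism : monoid_morphism conjc.
Proof.
split; first by rewrite /conjc /= oppr0.
by move=> x y; congr Cplx => /=; lra.
Qed.

HB.instance Definition _ := GRing.isZmodMorphism.Build (cplx R) (cplx R) conjc conjc_is_zmod_morphism.
HB.instance Definition _ := GRing.isMonoidMorphism.Build (cplx R) (cplx R) conjc conjc_is_monoid_morphism.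

Definition rc (a : R) : cplx R := Cplx a 0.

Lemma rc_is_zmod_morphism : zmod_morphism rc.
Proof. by move=> x y; congr Cplx; rewrite /= subr0. Qed.

Lemma rc_is_monoid_morphism : monoid_morphism rc.
Proof. by split=> [//|x y]; congr Cplx => /=; lra. Qed.

HB.instance Definition _ := GRing.isZmodMorphism.Build R (cplx R) rc rc_is_zmod_morphism.
HB.instance Definition _ := GRing.isMonoidMorphism.Build R (cplx R) rc rc_is_monoid_morphism.

Lemma cre_is_zmod_morphism : zmod_morphism (@cre R).
Proof. by []. Qed.

HB.instance Definition _ := GRing.isZmodMorphism.Build (cplx R) R (@cre R) cre_is_zmod_morphism.

Lemma mulcJ x : x * conjc x = rc (nsq x).
Proof. by congr Cplx; rewrite /= /nsq; lra. Qed.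

Lemma cre_rcM (a : R) x : cre (rc a * x) = a * cre x.
Proof. by rewrite /= mul0r subr0. Qed.

Lemma nsqM x y : nsq (x * y) = nsq x * nsq y.
Proof. by rewrite /nsq /=; lra. Qed.

Lemma nsq1 : nsq 1 = 1.
Proof. by rewrite /nsq /= expr1n expr0n addr0. Qed.

Lemma nsqX x n : nsq (x ^+ n) = nsq x ^+ n.
Proof. by elim: n => [|n IHn]; rewrite ?expr0 ?nsq1 // !exprS nsqM IHn. Qed.

Lemma nsq_prod (I : finType) (F : I -> cplx R) : nsq (\prod_i F i) = \prod_i nsq (F i).
Proof. exact: (big_morph _ nsqM nsq1). Qed.

Lemma nsq_conjc x : nsq (conjc x) = nsq x.
Proof. by rewrite /nsq /= sqrrN. Qed.

Lemma nsq_rc (a : R) : nsq (rc a) = a ^+ 2.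
Proof. by rewrite /nsq /= expr0n addr0. Qed.

Lemma conjcK : involutive conjc.
Proof. by case=> a b; rewrite /conjc /= opprK. Qed.

Lemma conjc_rc (a : R) : conjc (rc a) = rc a.
Proof. by rewrite /conjc /= oppr0. Qed.

Lemma nsqB x y : nsq (x - y) = nsq x + nsq y - 2 * cre (x * conjc y).
Proof. by rewrite /nsq /=; lra. Qed.

End CplxField.

Definition expi (R : realType) (t : R) : cplx R := Cplx (cos t) (sin t).

Lemma expiX (R : realType) (t : R) n : expi t ^+ n = expi (n%:R * t).
Proof.
elim: n => [|n IHn]; first by rewrite expr0 mul0r /expi cos0 sin0.
rewrite exprS {}IHn mulrSr mulrDl mul1r addrC /expi cosD sinD.
by congr Cplx; rewrite /= 1?addrC 1?[sin t * _]mulrC.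
Qed.

Lemma nsq_expi (R : realType) (t : R) : nsq (expi t) = 1.
Proof. exact: cos2Dsin2. Qed.

Lemma cplx_prim_root (R : realType) n : (0 < n)%N ->
  exists z : cplx R, n.-primitive_root z /\ nsq z = 1.
Proof.
move=> n0; exists (expi (2 * pi / n%:R)); split; last exact: nsq_expi.
have nR : n%:R != 0 :> R by rewrite pnatr_eq0 -lt0n.
apply/andP; split=> //; apply/forallP => i.
rewrite unity_rootE expiX.
have -> : i.+1%:R * (2 * pi / n%:R) = (i.+1%:R * pi / n%:R) *+ 2 :> R.
  by rewrite -mulr_natl; lra.
have [->|ni] := eqVneq i.+1 n.
  by rewrite mulrAC divff // mul1r /expi cos2pi sin2pi !eqxx.
have lt_in : (i.+1 < n)%N by rewrite ltn_neqAle ni ltn_ord.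
apply/eqP/negbTE/eqP => -[].
(* The power has argument [2 s] with [0 < s < pi], hence cosine [1 - 2 sin^2 s < 1]. *)
set s := _ / _.
have s0 : 0 < s by rewrite divr_gt0 ?mulr_gt0 ?pi_gt0 ?ltr0n.
have spi : s < pi.
  by rewrite ltr_pdivrMr ?ltr0n // mulrC ltr_pM2l ?pi_gt0 // ltr_nat.
rewrite cos_mulr2n cos2sin2 => H _.
have := @sin_gt0_pi R s; rewrite s0 spi => /(_ isT) sp.
have : 0 < sin s ^+ 2 by rewrite exprn_gt0.
lra.
Qed.

(** * Determinantal processes on a finite set *)

(** Fubini for a product weight: every coordinate except [i] and [j] sums out. *)
Lemma sum_ffun_pair (C : comNzRingType) (X : finType) (m : nat)
    (g : 'I_m -> X -> C) (f : X -> X -> C) (i j : 'I_m) : i != j ->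
  \sum_(x : {ffun 'I_m -> X}) f (x i) (x j) * \prod_k g k (x k) =
  (\prod_(k | (k != i) && (k != j)) \sum_z g k z) *
  \sum_y \sum_y' f y y' * (g i y * g j y').
Proof.
move=> ij.
(* The indicators of [x i = y] and [x j = y'] are put into the factors, so that the summand becomes
   a product over coordinates and the sum distributes. *)
pose G y y' k z := g k z * ((k == i) ==> (z == y))%:R * ((k == j) ==> (z == y'))%:R.
have E (x : {ffun 'I_m -> X}) : f (x i) (x j) * \prod_k g k (x k) =
    \sum_y \sum_y' f y y' * \prod_k G y y' k (x k).
  apply/esym; rewrite (bigD1 (x i)) //= (bigD1 (x j)) //=.
  rewrite [X in _ + X + _]big1 ?addr0 => [|y' y'x]; last first.
    rewrite (bigD1 j) //= /G eqxx /= [_ == y']eq_sym (negbTE y'x) mulr0 mul0r mulr0 //.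
  rewrite [X in _ + X]big1 ?addr0 => [|y yx]; last first.
    rewrite big1 // => y' _.
    by rewrite (bigD1 i) //= /G eqxx /= [_ == y]eq_sym (negbTE yx) mulr0 !mul0r mulr0.
  congr (_ * _); apply: eq_bigr => k _; rewrite /G.
  by case: (k =P i) => [ki|_]; case: (k =P j) => [kj|_] /=; rewrite -?ki -?kj ?eqxx !mulr1.
rewrite (eq_bigr _ (fun x _ => E x)).
rewrite exchange_big /= mulr_sumr; apply: eq_bigr => y _.
rewrite exchange_big /= mulr_sumr; apply: eq_bigr => y' _.
rewrite -mulr_sumr mulrCA; congr (_ * _).
rewrite -(bigA_distr_bigA (G y y')) /= (bigD1 i) //= (bigD1 j) //=; last by rewrite eq_sym.
have -> : \sum_z G y y' i z = g i y.
  rewrite (bigD1 y) //= big1 ?addr0 => [|z zy].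
    by rewrite /G !eqxx (negbTE ij) /= !mulr1.
  by rewrite /G eqxx (negbTE zy) /= mulr0 mul0r.
have -> : \sum_z G y y' j z = g j y'.
  rewrite (bigD1 y') //= big1 ?addr0 => [|z zy].
    by rewrite /G !eqxx [j == i]eq_sym (negbTE ij) /= !mulr1.
  by rewrite /G eqxx (negbTE zy) /= mulr0.
rewrite mulrA mulrC; congr (_ * _); apply: eq_bigr => k /andP[ki kj].
by apply: eq_bigr => z _; rewrite /G (negbTE ki) (negbTE kj) /= !mulr1.
Qed.

(** Expand the first determinant. Relabelling the points by [s] turns the term of [s] into that of
    the identity, the sign being absorbed by the second determinant; so the [m!] terms agree. *)
Lemma sum_symm_det2 (C : comNzRingType) (X : finType) (m : nat)
    (chi eta : 'I_m -> X -> C) (S : {ffun 'I_m -> X} -> C) :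
  (forall (s : 'S_m) (x : {ffun 'I_m -> X}), S [ffun k => x (s k)] = S x) ->
  \sum_(x : {ffun 'I_m -> X}) S x * (\det (\matrix_(k, l) chi k (x l)) *
     \det (\matrix_(k, l) eta k (x l))) =
  m`!%:R * \sum_(t : 'S_m) (-1) ^+ t *
    \sum_(x : {ffun 'I_m -> X}) S x * \prod_k (chi k (x k) * eta (t k) (x k)).
Proof.
move=> Ssym.
pose D (x : {ffun 'I_m -> X}) := \det (\matrix_(k, l) eta k (x l)).
have E1 (s : 'S_m) : \sum_(x : {ffun 'I_m -> X})
      S x * ((-1) ^+ s * \prod_k chi k (x (s k)) * D x) =
    \sum_(x : {ffun 'I_m -> X}) S x * (\prod_k chi k (x k) * D x).
  pose h (x : {ffun 'I_m -> X}) := [ffun k => x (s k)].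
  have hK : cancel (fun x : {ffun 'I_m -> X} => [ffun k => x ((s^-1)%g k)]) h.
    by move=> x; apply/ffunP => k; rewrite !ffunE permK.
  have Kh : cancel h (fun x : {ffun 'I_m -> X} => [ffun k => x ((s^-1)%g k)]).
    by move=> x; apply/ffunP => k; rewrite !ffunE permKV.
  rewrite [RHS](reindex h) /=; last by exists (fun x : {ffun 'I_m -> X} => [ffun k => x ((s^-1)%g k)]) => x _.
  apply: eq_bigr => x _; rewrite Ssym; congr (_ * _).
  have -> : D (h x) = (-1) ^+ s * D x.
    rewrite /D; have -> : \matrix_(k, l) eta k (h x l) = col_perm s (\matrix_(k, l) eta k (x l)).
      by apply/matrixP => k l; rewrite !mxE ffunE.
    by rewrite col_permE det_mulmx det_perm mulrC odd_permV.
  rewrite [RHS]mulrCA -mulrA; congr (_ * _); congr (_ * _).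
  by apply: eq_bigr => k _; rewrite ffunE.
transitivity (\sum_(s : 'S_m) \sum_(x : {ffun 'I_m -> X})
      S x * ((-1) ^+ s * \prod_k chi k (x (s k)) * D x)).
  rewrite exchange_big /=; apply: eq_bigr => x _.
  rewrite -mulr_sumr -mulr_suml; congr (_ * (_ * _)).
  by apply: eq_bigr => s _; congr (_ * _); apply: eq_bigr => k _; rewrite mxE.
rewrite (eq_bigr _ (fun s _ => E1 s)).
rewrite sumr_const card_Sn -[LHS]mulr_natl; congr (_ * _).
under [RHS]eq_bigr do rewrite mulr_sumr.
rewrite [RHS]exchange_big /=; apply: eq_bigr => x _.
rewrite /D -det_tr mulr_sumr mulr_sumr; apply: eq_bigr => t _.
rewrite [RHS]mulrCA; congr (_ * _); rewrite mulrCA; congr (_ * _).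
by rewrite -big_split /=; apply: eq_bigr => k _; rewrite !mxE.
Qed.

(* Divided by [nu k * nu l] and summed over [k] and [l], this is the two-point function
   [K y y * K y' y' - K y y' * K y' y] of the process with kernel
   [K y y' = \sum_k chi k y * eta k y' / nu k]. *)
Definition pair_density (C : pzRingType) (T I : Type) (chi eta : I -> T -> C)
    (k l : I) (y y' : T) : C :=
  chi k y * eta k y * (chi l y' * eta l y') - chi k y * eta l y * (chi l y' * eta k y').

Section DetMoments.
Variables (C : fieldType) (X : finType) (m : nat).
Variables (chi eta : 'I_m -> X -> C) (nu : 'I_m -> C).
Hypothesis orth : forall k l, \sum_x chi k x * eta l x = if k == l then nu k else 0.
Hypothesis nu_neq0 : forall k, nu k != 0.

Definition det2 (x : {ffun 'I_m -> X}) : C :=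
  \det (\matrix_(k, l) chi k (x l)) * \det (\matrix_(k, l) eta k (x l)).

(** Andréief's identity, giving the normalising constant: a permutation other than 1 moves some [k],
    whose factor vanishes by orthogonality. *)
Lemma sum_det2 : \sum_x det2 x = m`!%:R * \prod_k nu k.
Proof.
transitivity (\sum_x 1 * det2 x); first by apply: eq_bigr => x _; rewrite mul1r.
rewrite (@sum_symm_det2 C X m chi eta (fun _ => 1)) //; congr (_ * _).
rewrite (bigD1 (1%g : 'S_m)) //= odd_perm1 mul1r [X in _ + X]big1 ?addr0 => [|t t1].
  under eq_bigr do rewrite mul1r.
  rewrite -(bigA_distr_bigA (fun k z => chi k z * eta ((1%g : 'S_m) k) z)) /=.
  by apply: eq_bigr => k _; rewrite perm1 orth eqxx.
under eq_bigr do rewrite mul1r.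
rewrite -(bigA_distr_bigA (fun k z => chi k z * eta (t k) z)) /=.
have [k tk] : exists k, k != t k.
  apply/existsP; rewrite -[X in is_true X]negbK; apply/negP => /existsPn H.
  by move/eqP: t1; apply; apply/permP => k; rewrite perm1; apply/esym/eqP; rewrite -[_ == _]negbK H.
by rewrite (bigD1 k) //= orth (negbTE tk) mul0r mulr0.
Qed.

Lemma perm_fix_pair (i j : 'I_m) (t : 'S_m) : i != j ->
  (forall k, k != i -> k != j -> t k = k) -> t = 1%g \/ t = tperm i j.
Proof.
move=> ij fixt.
have tij k : k \in [:: i; j] -> t k \in [:: i; j].
  move=> kij; apply: contraT; rewrite !inE negb_or => /andP[ti tj].
  have /perm_inj tk := fixt _ ti tj; move: kij; rewrite !inE.
  by rewrite -tk (negbTE ti) (negbTE tj).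
have := tij i; have := tij j; rewrite !inE !eqxx orbT /= => /(_ isT) Tj /(_ isT) Ti.
have [tii|tii] := boolP (t i == i); [left|right]; apply/permP => k.
  rewrite perm1; have [->|ki] := eqVneq k i; first exact/eqP.
  have [kj|kj] := eqVneq k j; last exact: fixt.
  move: Tj; rewrite kj -{1}(eqP tii) (inj_eq perm_inj) eq_sym (negbTE ij) /=.
  by move/eqP.
rewrite (negbTE tii) /= in Ti.
have [->|ki] := eqVneq k i; first by rewrite tpermL (eqP Ti).
have [kj|kj] := eqVneq k j; last by rewrite tpermD 1?eq_sym // fixt.
move: Tj; rewrite kj tpermR -{3}(eqP Ti) (inj_eq perm_inj) [j == i]eq_sym (negbTE ij) orbF.
by move/eqP.
Qed.

(** Orthogonality kills each permutation that moves an index other than [i] and [j]; the identity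
    and the transposition [tperm i j] give the two terms of [pair_density]. *)
Lemma sum_perm_pair (f : X -> X -> C) (i j : 'I_m) : i != j ->
  \sum_(t : 'S_m) (-1) ^+ t *
     \sum_(x : {ffun 'I_m -> X}) f (x i) (x j) * \prod_k (chi k (x k) * eta (t k) (x k)) =
  (\prod_k nu k) * ((nu i * nu j)^-1 * \sum_y \sum_y' f y y' * pair_density chi eta i j y y').
Proof.
move=> ij; have ji : j != i by rewrite eq_sym.
rewrite (eq_bigr _ (fun (t : 'S_m) _ => congr1 ( *%R ((-1) ^+ t))
  (sum_ffun_pair (fun k z => chi k z * eta (t k) z) f ij))).
have T1 : tperm i j != 1%g :> 'S_m.
  by apply/eqP => /permP/(_ i); rewrite tpermL perm1 => /eqP; rewrite (negbTE ji).
rewrite (bigD1 (1%g : 'S_m)) //= (bigD1 (tperm i j)) //= [X in _ + (_ + X)]big1 ?addr0; last first.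
  move=> t /andP[t1 tT].
  have [k /andP[/andP[ki kj] tk]] : exists k, (k != i) && (k != j) && (t k != k).
    apply/existsP; rewrite -[X in is_true X]negbK; apply/negP => /existsPn H.
    have [||//] := @perm_fix_pair i j t ij; [|by move/eqP; rewrite (negbTE t1)|by move/eqP; rewrite (negbTE tT)].
    by move=> k ki kj; apply/eqP; move: (H k); rewrite ki kj /= negbK.
  rewrite (bigD1 k) ?ki //= (orth k (t k)) eq_sym (negbTE tk).
  by rewrite !mul0r mulr0.
rewrite odd_perm1 mul1r odd_tperm ij mulN1r.
pose P := \prod_(k < m | (k != i) && (k != j)) nu k.
have P1 : \prod_(k < m | (k != i) && (k != j)) (\sum_z chi k z * eta ((1%g : 'S_m) k) z) = P.
  by apply: eq_bigr => k _; rewrite perm1 orth eqxx.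
have P2 : \prod_(k < m | (k != i) && (k != j)) (\sum_z chi k z * eta (tperm i j k) z) = P.
  by apply: eq_bigr => k /andP[ki kj]; rewrite tpermD 1?eq_sym // orth eqxx.
have -> : \prod_k nu k = nu i * nu j * P by rewrite (bigD1 i) //= (bigD1 j) //= mulrA.
have ab : nu i * nu j != 0 by rewrite mulf_neq0.
rewrite P1 P2 -mulrBr [_ * P]mulrC -[RHS]mulrA mulVKf //; congr (_ * _).
rewrite -sumrB; apply: eq_bigr => y _; rewrite -sumrB; apply: eq_bigr => y' _.
by rewrite -mulrBr !perm1 tpermL tpermR.
Qed.

Lemma sum_pair_det2 (f : X -> X -> C) :
  \sum_(x : {ffun 'I_m -> X}) (\sum_i \sum_(j | i != j) f (x i) (x j)) * det2 x =
  m`!%:R * (\prod_k nu k) * \sum_k \sum_l (nu k * nu l)^-1 *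
    \sum_y \sum_y' f y y' * pair_density chi eta k l y y'.
Proof.
rewrite (sum_symm_det2 chi eta); last first.
  move=> s x; rewrite [RHS](reindex_inj (@perm_inj _ s)) /=; apply: eq_bigr => i _.
  rewrite [RHS](reindex_inj (@perm_inj _ s)) /=.
  by apply: eq_big => [j|j _]; rewrite ?(inj_eq perm_inj) // !ffunE.
rewrite -mulrA; congr (_ * _).
transitivity (\sum_i \sum_(j | i != j) \sum_(t : 'S_m) (-1) ^+ t *
     \sum_(x : {ffun 'I_m -> X}) f (x i) (x j) * \prod_k (chi k (x k) * eta (t k) (x k))).
  rewrite [RHS](eq_bigr _ (fun i _ => exchange_big _ _ _ _ _ _)) exchange_big /=.
  apply: eq_bigr => t _; rewrite -[RHS](eq_bigr _ (fun i _ => mulr_sumr _ _ _ _)) -mulr_sumr.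
  congr (_ * _); rewrite -[RHS](eq_bigr _ (fun i _ => exchange_big _ _ _ _ _ _)) exchange_big /=.
  apply: eq_bigr => x _; rewrite mulr_suml; apply: eq_bigr => i _.
  by rewrite mulr_suml.
rewrite mulr_sumr; apply: eq_bigr => i _.
(* The right-hand side also runs over equal indices, where [pair_density] vanishes. *)
rewrite mulr_sumr [RHS](bigD1 i) //= [X in _ * (_ * X) + _]big1 => [|y _]; last first.
  by rewrite big1 // => y' _; rewrite /pair_density subrr mulr0.
rewrite !mulr0 add0r; apply: eq_big => [j|j ij]; first by rewrite eq_sym.
exact: sum_perm_pair.
Qed.

End DetMoments.

(** * The spherical ensemble on a grid of Hopf fibres *)

(** Orthogonality of characters of the cyclic group; the bounds [k, l < q] make distinct exponents
    give distinct characters. *)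
Lemma sum_prim_root (R : realType) q (w : cplx R) k l :
  q.-primitive_root w -> nsq w = 1 -> (k < q)%N -> (l < q)%N ->
  \sum_(b < q) (w ^+ b) ^+ k * conjc ((w ^+ b) ^+ l) = if k == l then q%:R else 0.
Proof.
move=> prim_w w1 kq lq.
have cw n : w ^+ n * conjc (w ^+ n) = 1 by rewrite mulcJ nsqX w1 expr1n.
have [->|kl] := eqVneq k l.
  under eq_bigr do rewrite -exprM cw.
  by rewrite sumr_const card_ord.
pose u := w ^+ k * conjc (w ^+ l).
have E b : (w ^+ b) ^+ k * conjc ((w ^+ b) ^+ l) = u ^+ b.
  by rewrite /u exprMn -[in RHS]rmorphXn /= -!exprM ![(_ * b)%N]mulnC.
under eq_bigr do rewrite E.
have u1 : u - 1 != 0.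
  rewrite subr_eq0; apply/eqP => u1.
  have : w ^+ k == w ^+ l.
    by rewrite -[w ^+ k]mulr1 -(cw l) mulrCA mulrC -/u u1 mul1r.
  by rewrite (eq_prim_root_expr prim_w) !modn_small // (negbTE kl).
apply: (mulfI u1); rewrite -subrX1 mulr0 /u exprMn -rmorphXn /= -!exprM.
by rewrite ![(_ * q)%N]mulnC !exprM (prim_expr_order prim_w) !expr1n rmorph1 mulr1 subrr.
Qed.

Lemma sum_antisymm_pair (C : comNzRingType) n (w e f e' f' : 'I_n -> C) :
  \sum_k \sum_l w k * w l * (e k * f k * (e' l * f' l) - e k * f l * (e' l * f' k)) =
  (\sum_k w k * (e k * f k)) * (\sum_l w l * (e' l * f' l)) -
  (\sum_k w k * (e k * f' k)) * (\sum_l w l * (f l * e' l)).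
Proof.
rewrite !mulr_suml -sumrB; apply: eq_bigr => k _.
rewrite !mulr_sumr -sumrB; apply: eq_bigr => l _.
rewrite mulrBr; congr (_ - _); first by rewrite [RHS]mulrACA.
rewrite [RHS]mulrACA; congr (_ * _); rewrite [RHS]mulrACA; congr (_ * _).
exact: mulrC.
Qed.

Section HopfBase.
Variable R : realType.
Implicit Types p : cplx R * cplx R.

Lemma conjcM (x y : cplx R) : conjc (x * y) = conjc x * conjc y.
Proof. exact: rmorphM. Qed.

(* A pair [p] of squared norm 1 stands for its Hopf fibre, a point of [S^2]; if [t] is the
   Euclidean distance in [S^2] between the fibres of [p] and [p'], then
   [nsq (hdot p p') = 1 - t^2 / 4]. *)
Definition hdot p p' := p.1 * conjc p'.1 + p.2 * conjc p'.2.

Definition mono t k p := p.1 ^+ k * p.2 ^+ (t - k).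

(** The binomial theorem exhibits [hdot ^+ t] as the reproducing kernel of the homogeneous
    polynomials of degree [t]. It yields the moments of [nsq hdot] for every [t] and the two-point
    function for [t = M]. *)
Lemma hdotX t p p' : hdot p p' ^+ t =
  \sum_(k < t.+1) 'C(t, k)%:R * (mono t k p * conjc (mono t k p')).
Proof.
rewrite /hdot addrC exprDn; apply: eq_bigr => k _.
rewrite /mono rmorphM /= !rmorphXn /= -mulr_natl; congr (_ * _).
by rewrite mulrC !exprMn; exact: mulrACA.
Qed.

Lemma conjc_hdotX t p p' : conjc (hdot p p' ^+ t) =
  \sum_(k < t.+1) 'C(t, k)%:R * (conjc (mono t k p) * mono t k p').
Proof.
rewrite hdotX (raddf_sum (@conjc R)) /=; apply: eq_bigr => k _.
by rewrite (conjcM _ (mono t k p * _)) (conjcM (mono t k p)) conjcK (rmorph_nat (@conjc R)).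
Qed.

Lemma hdotxx p : nsq p.1 + nsq p.2 = 1 -> hdot p p = 1.
Proof. by move=> p1; rewrite /hdot !mulcJ -rmorphD p1 rmorph1. Qed.

Lemma nsq_mono_le1 t k p : nsq p.1 + nsq p.2 = 1 -> nsq (mono t k p) <= 1.
Proof.
move=> p1; rewrite /mono nsqM !nsqX.
have n1 := nsq_ge0 p.1; have n2 := nsq_ge0 p.2.
by rewrite mulr_ile1 ?exprn_ge0 // exprn_ile1 //; lra.
Qed.

Lemma nsq_hdot_le1 p p' : nsq p.1 + nsq p.2 = 1 -> nsq p'.1 + nsq p'.2 = 1 ->
  nsq (hdot p p') <= 1.
Proof.
rewrite /nsq /hdot /=; set a := cre p.1; set b := cim p.1; set c := cre p.2; set d := cim p.2.
set a' := cre p'.1; set b' := cim p'.1; set c' := cre p'.2; set d' := cim p'.2 => p1 p1'.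
(* Lagrange's identity: the last two squares add up to the squared modulus of
   [p.1 * p'.2 - p.2 * p'.1]. *)
suff -> : 1 = (a * a' - b * - b' + (c * c' - d * - d')) ^+ 2 +
  (a * - b' + b * a' + (c * - d' + d * c')) ^+ 2 +
  ((a * c' - b * d' - c * a' + d * b') ^+ 2 + (a * d' + b * c' - c * b' - d * a') ^+ 2).
  by rewrite lerDl addr_ge0 ?sqr_ge0.
transitivity ((a ^+ 2 + b ^+ 2 + (c ^+ 2 + d ^+ 2)) * (a' ^+ 2 + b' ^+ 2 + (c' ^+ 2 + d' ^+ 2))).
  by rewrite p1 p1' mulr1.
by lra.
Qed.

(** Equality case of Cauchy-Schwarz: the squared norm of [p - h p'], with [h = hdot p p'], is
    [1 - nsq h]. *)
Lemma nsq_hdot_eq1 p p' : nsq p.1 + nsq p.2 = 1 -> nsq p'.1 + nsq p'.2 = 1 ->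
  nsq (hdot p p') = 1 -> p = (hdot p p' * p'.1, hdot p p' * p'.2).
Proof.
move=> p1 p1' h1.
have : nsq (p.1 - hdot p p' * p'.1) + nsq (p.2 - hdot p p' * p'.2) = 0.
  rewrite !nsqB !nsqM h1 !mul1r !conjcM.
  have -> : cre (p.1 * (conjc (hdot p p') * conjc p'.1)) =
    cre (conjc (hdot p p') * (p.1 * conjc p'.1)) by rewrite mulrCA.
  have -> : cre (p.2 * (conjc (hdot p p') * conjc p'.2)) =
    cre (conjc (hdot p p') * (p.2 * conjc p'.2)) by rewrite mulrCA.
  have : cre (conjc (hdot p p') * (p.1 * conjc p'.1)) + cre (conjc (hdot p p') * (p.2 * conjc p'.2)) = 1.
    by rewrite -(raddfD (@cre R)) -mulrDr -/(hdot p p') mulrC mulcJ h1.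
  by move: (cre _) (cre _) => A B; lra.
move/eqP; rewrite paddr_eq0 ?nsq_ge0 // !nsq_eq0 !subr_eq0 => /andP[/eqP E1 /eqP E2].
by rewrite -E1 -E2; case: p {p1 h1 E1 E2}.
Qed.

Lemma sum_pair_density M p p' : nsq p.1 + nsq p.2 = 1 -> nsq p'.1 + nsq p'.2 = 1 ->
  \sum_(k < M.+1) \sum_(l < M.+1) 'C(M, k)%:R * 'C(M, l)%:R *
    pair_density (fun k : 'I_M.+1 => mono M k) (fun (k : 'I_M.+1) x => conjc (mono M k x)) k l p p' =
  rc (1 - nsq (hdot p p') ^+ M).
Proof.
move=> p1 p1'.
transitivity (hdot p p ^+ M * hdot p' p' ^+ M - hdot p p' ^+ M * conjc (hdot p p' ^+ M)).
  rewrite conjc_hdotX (hdotX M p p) (hdotX M p' p') (hdotX M p p').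
  exact: sum_antisymm_pair.
by rewrite !hdotxx // !expr1n mulr1 mulcJ nsqX rmorphB rmorph1.
Qed.

End HopfBase.

(* Tends to the Beta integral of [s^k (1 - s)^l]. *)
Definition riemann (R : realType) L k l : R :=
  (\sum_(a < L) (a%:R / L%:R) ^+ k * (1 - a%:R / L%:R) ^+ l) / L%:R.

Lemma sum_bilinear (C : comNzRingType) (X : finType) n (w : 'I_n -> C)
    (e f e' f' : 'I_n -> X -> C) :
  \sum_x \sum_y (\sum_k w k * (e k x * f k y)) * (\sum_l w l * (f' l x * e' l y)) =
  \sum_k \sum_l w k * w l * ((\sum_x e k x * f' l x) * (\sum_y f k y * e' l y)).
Proof.
have E x y : (\sum_k w k * (e k x * f k y)) * (\sum_l w l * (f' l x * e' l y)) =
    \sum_k \sum_l w k * w l * ((e k x * f' l x) * (f k y * e' l y)).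
  rewrite mulr_suml; apply: eq_bigr => k _; rewrite mulr_sumr; apply: eq_bigr => l _.
  by rewrite [LHS]mulrACA; congr (_ * _); rewrite mulrACA.
rewrite (eq_bigr _ (fun x _ => eq_bigr _ (fun y _ => E x y))).
rewrite [RHS](eq_bigr (fun k => \sum_x \sum_y \sum_l w k * w l * ((e k x * f' l x) * (f k y * e' l y)))).
  rewrite [RHS]exchange_big /=; apply: eq_bigr => x _.
  by rewrite [RHS]exchange_big.
move=> k _; rewrite [RHS](eq_bigr (fun x => \sum_l \sum_y w k * w l * ((e k x * f' l x) * (f k y * e' l y)))).
  rewrite [RHS]exchange_big /=; apply: eq_bigr => l _.
  rewrite mulr_suml mulr_sumr; apply: eq_bigr => x _.
  by rewrite mulr_sumr mulr_sumr.
by move=> x _; rewrite exchange_big.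
Qed.

Lemma cre_sum (R : realType) (I : finType) (F : I -> cplx R) :
  cre (\sum_i F i) = \sum_i cre (F i).
Proof. exact: raddf_sum. Qed.

Lemma rcM (R : realType) (a b : R) : rc (a * b) = rc a * rc b.
Proof. exact: rmorphM. Qed.

Lemma rcV (R : realType) (a : R) : rc a^-1 = (rc a)^-1.
Proof. exact: fmorphV. Qed.

Section Grid.
Variables (R : realType) (L q : nat) (w : cplx R).
Hypothesis (L_gt0 : (0 < L)%N) (prim_w : q.-primitive_root w) (w1 : nsq w = 1).

(* [s = |z|^2] and the relative phase are independent and uniform for a random point of
   [S^2], hence the equally spaced values. *)
Definition grid (x : 'I_L * 'I_q) : cplx R * cplx R :=
  (rc (Num.sqrt (x.1%:R / L%:R)) * w ^+ x.2, rc (Num.sqrt (1 - x.1%:R / L%:R))).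

Lemma frac_itv (a : 'I_L) : 0 <= a%:R / L%:R :> R /\ 0 <= 1 - a%:R / L%:R :> R.
Proof.
split; first by rewrite divr_ge0.
by rewrite subr_ge0 ler_pdivrMr ?ltr0n // mul1r ler_nat ltnW.
Qed.

Lemma grid_unit x : nsq (grid x).1 + nsq (grid x).2 = 1.
Proof.
have [s0 s1] := frac_itv x.1.
by rewrite /= nsqM !nsq_rc nsqX w1 expr1n mulr1 !sqr_sqrtr // addrC subrK.
Qed.

Lemma mono_grid t k a b : mono t k (grid (a, b)) =
  rc (Num.sqrt (a%:R / L%:R) ^+ k * Num.sqrt (1 - a%:R / L%:R) ^+ (t - k)) * (w ^+ b) ^+ k.
Proof.
by rewrite /mono /= exprMn -!rmorphXn /= rmorphM mulrAC.
Qed.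

(** The phases make distinct monomials exactly orthogonal once [t < q]; the grid is approximate only
    through the norms, which are Riemann sums. *)
Lemma grid_gram t k l : (t < q)%N -> (k <= t)%N -> (l <= t)%N ->
  \sum_x mono t k (grid x) * conjc (mono t l (grid x)) =
  if k == l then rc (q%:R * L%:R * riemann R L k (t - k)) else 0.
Proof.
move=> tq kt lt.
rewrite -(pair_bigA _ (fun a b => mono t k (grid (a, b)) * conjc (mono t l (grid (a, b))))) /=.
pose s1 (a : 'I_L) := Num.sqrt (a%:R / L%:R) : R.
pose s2 (a : 'I_L) := Num.sqrt (1 - a%:R / L%:R) : R.
have E a : \sum_b mono t k (grid (a, b)) * conjc (mono t l (grid (a, b))) =
   rc ((s1 a ^+ k * s2 a ^+ (t - k)) * (s1 a ^+ l * s2 a ^+ (t - l))) *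
   (if k == l then q%:R else 0).
  rewrite -(sum_prim_root prim_w w1) ?(leq_ltn_trans _ tq) // mulr_sumr.
  apply: eq_bigr => b _; rewrite !mono_grid conjcM conjc_rc [LHS]mulrACA.
  by rewrite -(rmorphM (@rc R)).
rewrite (eq_bigr _ (fun a _ => E a)); case: eqP => [<-|_]; last first.
  by rewrite big1 // => a _; rewrite mulr0.
rewrite -mulr_suml -(raddf_sum (@rc R)) -(rmorph_nat (@rc R)) -(rmorphM (@rc R)).
congr rc; rewrite mulrC -mulrA; congr (_ * _).
rewrite /riemann mulrC divfK ?pnatr_eq0 -?lt0n //; apply: eq_bigr => a _.
have [a0 a1] := frac_itv a.
by rewrite -expr2 exprMn -!exprM ![(_ * 2)%N]mulnC !exprM !sqr_sqrtr.
Qed.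

Lemma sum_hdot_grid t : (t < q)%N ->
  \sum_x \sum_y nsq (hdot (grid x) (grid y)) ^+ t =
  \sum_(k < t.+1) ('C(t, k)%:R * (q%:R * L%:R * riemann R L k (t - k))) ^+ 2.
Proof.
move=> tq.
suff : rc (\sum_x \sum_y nsq (hdot (grid x) (grid y)) ^+ t) =
  rc (\sum_(k < t.+1) ('C(t, k)%:R * (q%:R * L%:R * riemann R L k (t - k))) ^+ 2) by case.
rewrite !(raddf_sum (@rc R)) /=.
transitivity (\sum_x \sum_y
   (\sum_(k < t.+1) 'C(t, k)%:R * (mono t k (grid x) * conjc (mono t k (grid y)))) *
   (\sum_(l < t.+1) 'C(t, l)%:R * (conjc (mono t l (grid x)) * mono t l (grid y)))).
  apply: eq_bigr => x _; rewrite (raddf_sum (@rc R)) /=; apply: eq_bigr => y _.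
  by rewrite -hdotX -conjc_hdotX mulcJ nsqX.
rewrite (sum_bilinear (fun k : 'I_t.+1 => 'C(t, k)%:R)
  (fun k x => mono t k (grid x)) (fun k x => conjc (mono t k (grid x)))
  (fun k x => mono t k (grid x)) (fun k x => conjc (mono t k (grid x)))).
apply: eq_bigr => k _; rewrite (bigD1 k) //= [X in _ + X]big1 ?addr0; last first.
  move=> l lk; rewrite (grid_gram tq) ?leq_ord // eq_sym.
  by rewrite (inj_eq (@ord_inj _)) (negbTE lk) mul0r mulr0.
have -> : \sum_x conjc (mono t k (grid x)) * mono t k (grid x) =
    \sum_x mono t k (grid x) * conjc (mono t k (grid x)).
  by apply: eq_bigr => x _; rewrite mulrC.
rewrite (grid_gram tq) ?leq_ord // eqxx -!expr2 -exprMn rmorphXn /=.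
by rewrite -(rmorph_nat (@rc R) 'C(t, k)) -(rmorphM (@rc R)).
Qed.

Definition grid_density M (k l : 'I_M.+1) x y : R :=
  cre (pair_density (fun k : 'I_M.+1 => mono M k)
    (fun (k : 'I_M.+1) x => conjc (mono M k x)) k l (grid x) (grid y)).

(** First-moment argument with weight the squared modulus of the determinant. That the fibres are
    distinct comes for free, since the chosen sample has nonzero weight. *)
Lemma exists_hopf_sample M (F : R -> R) : (M < q)%N ->
  (forall k : 'I_M.+1, 0 < riemann R L k (M - k)) ->
  exists p : 'I_M.+1 -> cplx R * cplx R,
  [/\ forall i, nsq (p i).1 + nsq (p i).2 = 1,
      forall i j, i != j -> nsq (hdot (p i) (p j)) < 1 &
      \sum_i \sum_(j | i != j) F (nsq (hdot (p i) (p j))) <=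
      \sum_(k < M.+1) \sum_(l < M.+1)
        (riemann R L k (M - k) * riemann R L l (M - l))^-1 *
        ((q%:R * L%:R) ^- 2 * \sum_x \sum_y F (nsq (hdot (grid x) (grid y))) *
        grid_density k l x y)].
Proof.
move=> Mq rpos; pose E := \sum_(k < M.+1) \sum_(l < M.+1)
  (riemann R L k (M - k) * riemann R L l (M - l))^-1 *
  ((q%:R * L%:R) ^- 2 * \sum_x \sum_y F (nsq (hdot (grid x) (grid y))) *
  grid_density k l x y).
have qL : 0 < q%:R * L%:R :> R.
  by rewrite mulr_gt0 ?ltr0n ?(leq_ltn_trans _ Mq).
pose chi (k : 'I_M.+1) x := mono M k (grid x).
pose eta (k : 'I_M.+1) x := conjc (chi k x).
pose nu (k : 'I_M.+1) : R := q%:R * L%:R * riemann R L k (M - k).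
have nu0 k : 0 < nu k by rewrite mulr_gt0.
have orth k l : \sum_x chi k x * eta l x = if k == l then rc (nu k) else 0.
  by rewrite (grid_gram Mq) ?leq_ord // (inj_eq (@ord_inj _)).
have nuc k : rc (nu k) != 0.
  by rewrite -nsq_eq0 nsq_rc sqrf_eq0 gt_eqF.
pose N (x : {ffun 'I_M.+1 -> 'I_L * 'I_q}) : R := nsq (\det (\matrix_(k, l) chi k (x l))).
have NE x : det2 chi eta x = rc (N x).
  rewrite /N -mulcJ /det2; congr (_ * _).
  by rewrite -det_map_mx; congr (\det _); apply/matrixP => k l; rewrite !mxE.
pose Z : R := (M.+1)`!%:R * \prod_k nu k.
have Z0 : 0 < Z by rewrite mulr_gt0 ?ltr0n ?fact_gt0 // prodr_gt0.
have sumN : \sum_x N x = Z.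
  suff : rc (\sum_x N x) = rc Z by case.
  rewrite (raddf_sum (@rc R)) /= -(eq_bigr _ (fun x _ => NE x)) (sum_det2 orth).
  by rewrite /Z rmorphM (rmorph_nat (@rc R)) (rmorph_prod (@rc R)).
pose S (x : {ffun 'I_M.+1 -> 'I_L * 'I_q}) :=
  \sum_i \sum_(j | i != j) F (nsq (hdot (grid (x i)) (grid (x j)))).
have sumS : \sum_x S x * N x = Z * E.
  have := sum_pair_det2 orth nuc (fun x y => rc (F (nsq (hdot (grid x) (grid y))))).
  have -> : \sum_(x : {ffun 'I_M.+1 -> 'I_L * 'I_q}) (\sum_i \sum_(j | i != j)
      rc (F (nsq (hdot (grid (x i)) (grid (x j)))))) * det2 chi eta x =
      rc (\sum_x S x * N x).
    rewrite (raddf_sum (@rc R)) /=; apply: eq_bigr => x _.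
    rewrite NE rmorphM; congr (_ * _).
    rewrite (raddf_sum (@rc R)) /=; apply: eq_bigr => i _.
    by rewrite (raddf_sum (@rc R)).
  rewrite -(rmorph_nat (@rc R)) -(rmorph_prod (@rc R)) -(rmorphM (@rc R)) -/Z.
  move/(congr1 (@cre R)); rewrite cre_rcM -[LHS]/(\sum_x S x * N x) => ->; congr (_ * _).
  rewrite cre_sum; apply: eq_bigr => k _; rewrite cre_sum; apply: eq_bigr => l _.
  rewrite -rcM -rcV cre_rcM.
  have -> : (nu k * nu l)^-1 = (riemann R L k (M - k) * riemann R L l (M - l))^-1 *
      (q%:R * L%:R) ^- 2.
    by rewrite -invfM; congr (_^-1); rewrite /nu; lra.
  rewrite -mulrA; congr (_ * (_ * _)).
  rewrite cre_sum; apply: eq_bigr => x _; rewrite cre_sum; apply: eq_bigr => y _.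
  by rewrite cre_rcM.
(* Otherwise all terms of [\sum_x (S x - E) * N x = 0] are nonnegative, and [N] would vanish
   identically against [Z > 0]. *)
have [x Nx Sx] : exists2 x, N x != 0 & S x <= E.
  apply: contrapT => H.
  have H' x : N x != 0 -> E < S x.
    by move=> Nx; rewrite ltNge; apply/negP => Sx; apply: H; exists x.
  have N0 x : 0 <= N x by exact: nsq_ge0.
  have pos x : true -> 0 <= (S x - E) * N x.
    move=> _; have [->|/H' ES] := eqVneq (N x) 0; first by rewrite mulr0.
    by rewrite mulr_ge0 // subr_ge0 ltW.
  have : \sum_x (S x - E) * N x = 0.
    rewrite (eq_bigr (fun x => S x * N x - E * N x)); last by move=> x _; rewrite mulrBl.
    by rewrite sumrB sumS -mulr_sumr sumN mulrC subrr.
  move/(psumr_eq0P pos) => SN0.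
  have : \sum_x N x = 0.
    apply: big1 => x _; apply/eqP; apply: contraT => Nx.
    have /eqP := SN0 x isT; rewrite mulf_eq0 (negbTE Nx) orbF subr_eq0.
    by rewrite gt_eqF // H'.
  by rewrite sumN => Z00; rewrite Z00 ltxx in Z0.
exists (fun i => grid (x i)); split=> [i|i j ij|//]; first exact: grid_unit.
rewrite lt_neqAle nsq_hdot_le1 ?grid_unit // andbT.
(* If two sampled fibres coincide, homogeneity of degree [M] makes two columns of the matrix
   proportional, with factor [c ^+ M]. *)
apply: contraNneq Nx => h1.
have E1 := nsq_hdot_eq1 (grid_unit _) (grid_unit _) h1.
rewrite /N nsq_eq0 -det_tr; apply/det0P.
set c := hdot _ _ in E1.
exists (delta_mx 0 i - c ^+ M *: delta_mx 0 j).
  apply/eqP => /matrixP/(_ 0 i)/eqP; rewrite !mxE !eqxx (negbTE ij) mulr0 subr0.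
  by rewrite oner_eq0.
rewrite mulmxBl -scalemxAl -!rowE; apply/rowP => k; rewrite !mxE /chi E1 /mono /=.
by rewrite !exprMn mulrACA -exprD subnKC ?leq_ord // subrr.
Qed.

End Grid.

(** * Limits of the Riemann sums and moments as the grid is refined *)

Lemma cvg_fin_sum (R : realType) (I : finType) (u : I -> nat -> R) (l : I -> R) :
  (forall i, u i n @[n --> \oo] --> l i) ->
  \sum_i u i n @[n --> \oo] --> \sum_i l i.
Proof.
move=> ul; elim: (index_enum I) => [|i s IHs].
  rewrite big_nil; under eq_fun do rewrite big_nil.
  exact: cvg_cst.
rewrite big_cons; under eq_fun do rewrite big_cons.
exact: cvgD (ul i) IHs.
Qed.

Lemma sum_pow_le (R : realType) (L k : nat) :
  (k.+1)%:R * \sum_(a < L) a%:R ^+ k <= L%:R ^+ k.+1 :> R.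
Proof.
elim: L => [|L IHL]; first by rewrite big_ord0 mulr0 exprn_ge0.
rewrite big_ord_recr /= mulrDr; apply: (le_trans (lerD IHL (lexx _))).
rewrite (mulrSr _ L); elim: k {IHL} => [|k IHk]; first by rewrite !expr1 expr0 mulr1.
have L0 : 0 <= L%:R :> R by [].
have := ler_wpM2r (addr_ge0 L0 ler01) IHk.
rewrite -exprSr; apply: le_trans.
rewrite !exprS (mulrSr _ k.+1).
have : 0 <= L%:R ^+ k :> R by rewrite exprn_ge0.
have : 0 <= k.+1%:R * L%:R ^+ k :> R by rewrite mulr_ge0 ?exprn_ge0.
by nra.
Qed.

(** Together with [sum_pow_le] this places [riemann R L k 0] within [1 / L] of [1 / (k + 1)]. *)
Lemma sum_pow_ge (R : realType) (L k : nat) :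
  L%:R ^+ k.+1 <= (k.+1)%:R * (\sum_(a < L) a%:R ^+ k + L%:R ^+ k) :> R.
Proof.
elim: L => [|L IHL]; first by rewrite expr0n /= mulr_ge0 // addr_ge0 ?big_ord0 ?exprn_ge0.
rewrite big_ord_recr /= mulrDr.
suff : (L.+1)%:R ^+ k.+1 <= L%:R ^+ k.+1 + k.+1%:R * L.+1%:R ^+ k :> R by lra.
rewrite (mulrSr _ L); have : 0 <= L%:R :> R by []; move: (L%:R) => x x0.
elim: k {IHL} => [|k IHk]; first by rewrite !expr1 expr0 mulr1.
have := ler_wpM2r (addr_ge0 x0 ler01) IHk.
rewrite -exprSr => /le_trans; apply.
have : x ^+ k.+1 <= (x + 1) ^+ k.+1 by rewrite lerXn2r ?nnegrE ?addr_ge0 // lerDl.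
by rewrite [x ^+ k.+2]exprS [(x + 1) ^+ k.+1]exprS (mulrSr _ k.+1); lra.
Qed.

Lemma cvg_riemann0 (R : realType) k :
  riemann R n.+1 k 0 @[n --> \oo] --> (k.+1%:R^-1 : R).
Proof.
have rE n : riemann R n.+1 k 0 = (\sum_(a < n.+1) a%:R ^+ k) / n.+1%:R ^+ k.+1.
  rewrite /riemann exprS invfM [in RHS]mulrA [RHS]mulrAC; congr (_ / _).
  rewrite mulr_suml; apply: eq_bigr => a _.
  by rewrite expr0 mulr1 exprMn exprVn.
have k0 : 0 < k.+1%:R :> R by rewrite ltr0n.
apply: (@squeeze_cvgr _ _ _ _ (fun n => k.+1%:R^-1 - n.+1%:R^-1) (fun _ => k.+1%:R^-1)).
- near=> n; have n0 : 0 < n.+1%:R ^+ k.+1 :> R by rewrite exprn_gt0 ?ltr0n.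
  rewrite rE; apply/andP; split; last first.
    by rewrite ler_pdivrMr // mulrC ler_pdivlMr // mulrC sum_pow_le.
  rewrite ler_pdivlMr // mulrBl -(ler_pM2l k0) mulrBr mulVKf ?gt_eqF //.
  rewrite [n.+1%:R ^+ k.+1 in X in _ - X]exprS mulKf ?pnatr_eq0 //.
  by rewrite lerBlDr -mulrDr sum_pow_ge.
- rewrite -[X in _ --> X]subr0; apply: cvgB; first exact: cvg_cst.
  exact: cvg_harmonic.
- exact: cvg_cst.
Unshelve. all: by end_near.
Qed.

(** Induction on [l] by [s^k (1 - s)^(l+1) = s^k (1 - s)^l - s^(k+1) (1 - s)^l], which reduces the
    Beta integral to pure powers. *)
Lemma cvg_riemann (R : realType) k l :
  riemann R n.+1 k l @[n --> \oo] --> ((k`! * l`!)%:R / (k + l).+1`!%:R : R).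
Proof.
elim: l k => [|l IHl] k.
  rewrite fact0 muln1 addn0 factS natrM invfM mulrCA mulfV ?mulr1; first exact: cvg_riemann0.
  by rewrite pnatr_eq0 -lt0n fact_gt0.
have -> : (fun n => riemann R n.+1 k l.+1) = (fun n => riemann R n.+1 k l - riemann R n.+1 k.+1 l).
  apply/funext => n; rewrite /riemann -mulrBl -sumrB; congr (_ / _); apply: eq_bigr => a _.
  by move: (_ / _) => s; rewrite [_ ^+ l.+1]exprS [_ ^+ k.+1]exprS; lra.
have -> : (k`! * l.+1`!)%:R / (k + l.+1).+1`!%:R =
   (k`! * l`!)%:R / (k + l).+1`!%:R - (k.+1`! * l`!)%:R / (k.+1 + l).+1`!%:R :> R.
  have n0 : (k + l).+2%:R != 0 :> R by rewrite pnatr_eq0.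
  have E1 : ((k + l).+2`!%:R)^-1 = (k + l).+2%:R^-1 * ((k + l).+1`!%:R)^-1 :> R.
    by rewrite -invfM -natrM -factS.
  have E2 n : n.+1`!%:R = n.+1%:R * n`!%:R :> R by rewrite -natrM -factS.
  have := mulfV n0; rewrite addnS addSn.
  rewrite (natrM _ k`! l`!) (natrM _ k`! l.+1`!) (natrM _ k.+1`! l`!) E1 (E2 k) (E2 l).
  move: ((k + l).+1`!%:R^-1) (k`!%:R) (l`!%:R) => F K' L'.
  rewrite -addSn -addnS (natrD _ k.+1); move: (_^-1) => z zE.
  transitivity ((k.+1%:R + l.+1%:R) * z * (K' * L' * F) - k.+1%:R * z * (K' * L' * F)); first by lra.
  by rewrite zE; lra.
by apply: cvgB.
Qed.

Lemma cvg_riemann_binom (R : realType) t k : (k <= t)%N ->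
  riemann R n.+1 k (t - k) @[n --> \oo] --> ((t.+1%:R * 'C(t, k)%:R)^-1 : R).
Proof.
move=> kt; have := @cvg_riemann R k (t - k); rewrite subnKC //.
suff -> : (t.+1%:R * 'C(t, k)%:R)^-1 = (k`! * (t - k)`!)%:R / t.+1`!%:R :> R by [].
have f0 : (k`! * (t - k)`!)%:R != 0 :> R by rewrite pnatr_eq0 -lt0n muln_gt0 !fact_gt0.
have -> : t.+1`!%:R = t.+1%:R * 'C(t, k)%:R * (k`! * (t - k)`!)%:R :> R.
  by rewrite -!natrM -mulnA bin_fact // -factS.
by rewrite [RHS]mulrC [in RHS]invfM divfK.
Qed.

(** For [t < q], the mean of [nsq hdot ^+ t] over pairs of grid points, as computed by
    [sum_hdot_grid]; written so, it depends on neither [q] nor [w]. *)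
Definition hdot_moment (R : realType) L t : R :=
  \sum_(k < t.+1) ('C(t, k)%:R * riemann R L k (t - k)) ^+ 2.

Lemma cvg_hdot_moment (R : realType) t :
  hdot_moment R n.+1 t @[n --> \oo] --> (t.+1%:R^-1 : R).
Proof.
have -> : t.+1%:R^-1 = \sum_(k < t.+1) ('C(t, k)%:R * (t.+1%:R * 'C(t, k)%:R)^-1) ^+ 2 :> R.
  transitivity (\sum_(k < t.+1) (t.+1%:R^-1 : R) ^+ 2).
    rewrite sumr_const card_ord -[RHS]mulr_natl expr2 mulrA mulfV ?mul1r // pnatr_eq0 //.
  apply: eq_bigr => k _; congr (_ ^+ 2).
  rewrite invfM mulrCA mulfV ?mulr1 // pnatr_eq0 -lt0n bin_gt0 leq_ord //.
apply: cvg_fin_sum => k; rewrite expr2; under eq_fun do rewrite expr2.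
have := @cvg_riemann_binom R t k; rewrite leq_ord => /(_ isT) H.
by apply: cvgM; (apply: cvgM; [exact: cvg_cst|exact: H]).
Qed.

(** * From the grid to the mean energy of the ensemble *)

Lemma creB (R : realType) (x y : cplx R) : cre (x - y) = cre x - cre y.
Proof. by []. Qed.

Lemma norm_cre_le1 (R : realType) (z : cplx R) : nsq z <= 1 -> `|cre z| <= 1.
Proof.
move=> z1; rewrite -[leRHS]normr1 -ler_sqr ?nnegrE ?normr_ge0 // !real_normK ?num_real //.
by rewrite expr1n (le_trans _ z1) // lerDl sqr_ge0.
Qed.

Lemma norm_grid_density_le (R : realType) L q (w : cplx R) M (k l : 'I_M.+1)
  (x y : 'I_L * 'I_q) : (0 < L)%N -> nsq w = 1 -> `|grid_density w k l x y| <= 2.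
Proof.
move=> L0 w1; rewrite /grid_density /pair_density creB.
rewrite (le_trans (ler_normB _ _)) // (_ : 2 = 1 + 1 :> R) //.
have P (a b c d : cplx R) : nsq a <= 1 -> nsq b <= 1 -> nsq c <= 1 -> nsq d <= 1 ->
    `|cre (a * b * (c * d))| <= 1.
  move=> a1 b1 c1 d1; apply: norm_cre_le1; rewrite !nsqM.
  by do ?apply: mulr_ile1; rewrite ?mulr_ge0 ?nsq_ge0.
have mono1 (z : 'I_L * 'I_q) : nsq (mono M k (grid w z)) <= 1 by apply: nsq_mono_le1; exact: grid_unit L0 w1 z.
have mono2 (z : 'I_L * 'I_q) : nsq (mono M l (grid w z)) <= 1 by apply: nsq_mono_le1; exact: grid_unit L0 w1 z.
by apply: lerD; apply: P; rewrite ?nsq_conjc.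
Qed.

Lemma sum_grid_density (R : realType) L q (w : cplx R) M (x y : 'I_L * 'I_q) :
  (0 < L)%N -> nsq w = 1 ->
  \sum_(k < M.+1) \sum_(l < M.+1) 'C(M, k)%:R * 'C(M, l)%:R * grid_density w k l x y =
  1 - nsq (hdot (grid w x) (grid w y)) ^+ M.
Proof.
move=> L0 w1; have := sum_pair_density M (grid_unit L0 w1 x) (grid_unit L0 w1 y).
move/(congr1 (@cre R)); rewrite [RHS]/= => <-.
rewrite cre_sum; apply: eq_bigr => k _; rewrite cre_sum; apply: eq_bigr => l _.
by rewrite -!(rmorph_nat (@rc R)) -rcM cre_rcM.
Qed.

(** Replacing the inverse norms by their limits [(M + 1) 'C(M, k)] gives the density [1 - v^M]
    exactly, hence a difference of moments. The last term pays for the replacement, using that [F]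
    is at most [\sum_j b j] and the pair density at most 2. The condition on [q] covers all moments
    up to order [K + M]. *)
Lemma grid_energy_le (R : realType) L q (w : cplx R) M K (b : 'I_K -> R) :
  (0 < L)%N -> q.-primitive_root w -> nsq w = 1 -> (M + K < q)%N ->
  (forall k, 0 <= b k) ->
  \sum_(k < M.+1) \sum_(l < M.+1)
        (riemann R L k (M - k) * riemann R L l (M - l))^-1 *
        ((q%:R * L%:R) ^- 2 * \sum_(x : 'I_L * 'I_q) \sum_(y : 'I_L * 'I_q)
           (\sum_(j < K) b j * nsq (hdot (grid w x) (grid w y)) ^+ j.+1) *
        grid_density w k l x y) <=
  M.+1%:R ^+ 2 * (\sum_(j < K) b j * (hdot_moment R L j.+1 - hdot_moment R L (j.+1 + M))) +
  2 * (\sum_j b j) * \sum_(k < M.+1) \sum_(l < M.+1)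
    `|(riemann R L k (M - k) * riemann R L l (M - l))^-1 -
      M.+1%:R * 'C(M, k)%:R * (M.+1%:R * 'C(M, l)%:R)|.
Proof.
move=> L0 prim_w w1 MKq b0.
set n := q%:R * L%:R : R.
have n0 : 0 < n by rewrite mulr_gt0 ?ltr0n // (leq_ltn_trans _ MKq).
pose v (x y : 'I_L * 'I_q) := nsq (hdot (grid w x) (grid w y)).
pose F x y := \sum_(j < K) b j * v x y ^+ j.+1.
pose A (k l : 'I_M.+1) := n ^- 2 * \sum_x \sum_y F x y * grid_density w k l x y.
have v01 x y : 0 <= v x y <= 1.
  by rewrite nsq_ge0 nsq_hdot_le1 // grid_unit.
pose B := \sum_j b j.
have F0B x y : 0 <= F x y <= B.
  have /andP[v0 v1] := v01 x y.
  rewrite sumr_ge0 ?ler_sum // => j _; last by rewrite mulr_ge0 // exprn_ge0.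
  by rewrite ler_piMr // exprn_ile1.
have A_le k l : `|A k l| <= 2 * B.
  have n2 : 0 < n ^+ 2 by rewrite exprn_gt0.
  rewrite /A normrM gtr0_norm ?invr_gt0 // ler_pdivrMl //.
  rewrite (le_trans (ler_norm_sum _ _ _)) //.
  have -> : n ^+ 2 * (2 * B) = \sum_(x : 'I_L * 'I_q) \sum_(y : 'I_L * 'I_q) 2 * B.
    rewrite !sumr_const !card_prod !card_ord -mulrnA -[RHS]mulr_natl; congr (_ * _).
    by rewrite !natrM /n; lra.
  apply: ler_sum => x _; rewrite (le_trans (ler_norm_sum _ _ _)) //; apply: ler_sum => y _.
  have /andP[F0 FB] := F0B x y.
  by rewrite normrM (ger0_norm F0) mulrC ler_pM // norm_grid_density_le.
pose h (k l : 'I_M.+1) : R := M.+1%:R * 'C(M, k)%:R * (M.+1%:R * 'C(M, l)%:R).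
have hA : \sum_k \sum_l h k l * A k l =
    M.+1%:R ^+ 2 * (\sum_(j < K) b j * (hdot_moment R L j.+1 - hdot_moment R L (j.+1 + M))).
  transitivity (M.+1%:R ^+ 2 * (n ^- 2 * \sum_x \sum_y F x y * (1 - v x y ^+ M))).
    transitivity (\sum_(k < M.+1) \sum_(l < M.+1) \sum_x \sum_y (M.+1%:R ^+ 2 * n ^- 2 * F x y) *
       ('C(M, k)%:R * 'C(M, l)%:R * grid_density w k l x y)).
      apply: eq_bigr => k _; apply: eq_bigr => l _; rewrite /A mulrA mulr_sumr.
      apply: eq_bigr => x _; rewrite mulr_sumr; apply: eq_bigr => y _; rewrite /h.
      by move: (n ^- 2) => z; lra.
    rewrite (eq_bigr _ (fun k _ => exchange_big _ _ _ _ _ _)) exchange_big /=.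
    rewrite mulrA mulr_sumr; apply: eq_bigr => x _.
    rewrite (eq_bigr _ (fun k _ => exchange_big _ _ _ _ _ _)) exchange_big /=.
    rewrite mulr_sumr; apply: eq_bigr => y _.
    rewrite mulrA -(sum_grid_density M x y L0 w1) [RHS]mulr_sumr; apply: eq_bigr => k _.
    by rewrite [RHS]mulr_sumr.
  congr (_ * _).
  have mom t : (t < q)%N -> hdot_moment R L t = n ^- 2 * \sum_x \sum_y v x y ^+ t.
    move=> tq; rewrite (sum_hdot_grid L0 prim_w w1 tq) mulr_sumr; apply: eq_bigr => k _.
    by rewrite -/n (mulrCA _ n) (exprMn 2 n) mulKf // expf_neq0 // gt_eqF.
  transitivity (\sum_(j < K) b j * (n ^- 2 * \sum_x \sum_y (v x y ^+ j.+1 - v x y ^+ (j.+1 + M)))).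
    rewrite [RHS](eq_bigr (fun j : 'I_K => \sum_x \sum_y n ^- 2 * b j * (v x y ^+ j.+1 - v x y ^+ (j.+1 + M)))).
      rewrite [RHS]exchange_big mulr_sumr; apply: eq_bigr => x _.
      rewrite [RHS]exchange_big mulr_sumr; apply: eq_bigr => y _.
      rewrite mulr_suml mulr_sumr; apply: eq_bigr => j _.
      by rewrite exprD; move: (n ^- 2) => z; lra.
    move=> j _; rewrite mulrA [b j * _]mulrC mulr_sumr; apply: eq_bigr => x _.
    by rewrite [LHS]mulr_sumr.
  apply: eq_bigr => j _; congr (_ * _).
  rewrite !mom; last 2 first.
  - by rewrite (leq_ltn_trans _ MKq) // addnC leq_add2l.
  - by rewrite (leq_ltn_trans _ MKq) // ltn_addl.
  rewrite -mulrBr; congr (_ * _); rewrite -sumrB; apply: eq_bigr => x _.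
  by rewrite -sumrB.
rewrite -hA /h mulr_sumr -big_split /=; apply: ler_sum => k _.
rewrite mulr_sumr -big_split /=; apply: ler_sum => l _.
rewrite -/n -/(A k l) -lerBlDl -mulrBl (le_trans (ler_norm _)) // normrM mulrC.
by rewrite ler_wpM2r.
Qed.

Lemma riemann_gt0 (R : realType) L k l : (1 < L)%N -> 0 < riemann R L k l.
Proof.
move=> L1; have L0 : 0 < L%:R :> R by rewrite ltr0n (ltn_trans _ L1).
rewrite divr_gt0 // (bigD1 (Ordinal L1)) //= ltr_wpDr //.
  rewrite sumr_ge0 // => a _; rewrite mulr_ge0 ?exprn_ge0 ?divr_ge0 //.
  by rewrite subr_ge0 ler_pdivrMr // mul1r ler_nat ltnW.
rewrite mulr_gt0 ?exprn_gt0 ?divr_gt0 // subr_gt0 ltr_pdivrMr // mul1r.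
by rewrite ltr_nat.
Qed.

(* The expected energy of the projection determinantal process of the monomials z^k w^(M-k),
   whose two-point function is m^2 (1 - v^(m-1)) with m = M + 1. *)
Lemma exists_hopf_config (R : realType) M K (b : 'I_K -> R) (d : R) :
  (forall k, 0 <= b k) -> 0 < d ->
  exists p : 'I_M.+1 -> cplx R * cplx R,
  [/\ forall i, nsq (p i).1 + nsq (p i).2 = 1,
      forall i j, i != j -> nsq (hdot (p i) (p j)) < 1 &
      \sum_i \sum_(j | i != j) \sum_(k < K) b k * nsq (hdot (p i) (p j)) ^+ k.+1 <=
      M.+1%:R ^+ 2 * (\sum_(k < K) b k * (k.+2%:R^-1 - (k.+1 + M.+1)%:R^-1)) + d].
Proof.
move=> b0 d0.
have [w [prim_w w1]] := @cplx_prim_root R (M + K).+1 isT.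
pose U n := M.+1%:R ^+ 2 * (\sum_(j < K) b j *
    (hdot_moment R n.+1 j.+1 - hdot_moment R n.+1 (j.+1 + M))) +
  2 * (\sum_j b j) * \sum_(k < M.+1) \sum_(l < M.+1)
    `|(riemann R n.+1 k (M - k) * riemann R n.+1 l (M - l))^-1 -
      M.+1%:R * 'C(M, k)%:R * (M.+1%:R * 'C(M, l)%:R)|.
set T := (X in X + d).
have UT : U n @[n --> \oo] --> T.
  rewrite -[T]addr0; apply: cvgD.
    apply: cvgM; first exact: cvg_cst.
    apply: cvg_fin_sum => j; apply: cvgM; first exact: cvg_cst.
    by rewrite addnS; apply: cvgB; exact: cvg_hdot_moment.
  rewrite -[X in _ --> X](mulr0 (2 * (\sum_j b j))); apply: cvgM; first exact: cvg_cst.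
  have z : \sum_(k < M.+1) \sum_(l < M.+1) 0 = 0 :> R.
    by rewrite big1 // => k _; rewrite big1.
  rewrite -[X in _ --> X]z.
  apply: cvg_fin_sum => k; apply: cvg_fin_sum => l.
  rewrite -[X in _ --> X](@normr0 _ R); apply: cvg_norm.
  set c := M.+1%:R * 'C(M, k)%:R * _.
  rewrite -[X in _ --> X](subrr c); apply: cvgB; last exact: cvg_cst.
  have Ck (i : 'I_M.+1) : M.+1%:R * 'C(M, i)%:R != 0 :> R.
    by rewrite mulf_neq0 // pnatr_eq0 -lt0n bin_gt0 leq_ord.
  have := @cvg_riemann_binom R M k; rewrite leq_ord => /(_ isT) Hk.
  have := @cvg_riemann_binom R M l; rewrite leq_ord => /(_ isT) Hl.
  have -> : c = ((M.+1%:R * 'C(M, k)%:R)^-1 * (M.+1%:R * 'C(M, l)%:R)^-1)^-1.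
    by rewrite invfM !invrK.
  apply: cvgV; last exact: cvgM.
  by rewrite mulf_neq0 // invr_eq0.
have Td : T < T + d by rewrite ltrDl.
have [N _ NU] := cvgr_lt _ UT _ Td.
(* The index [N.+1] gives a grid of size [N.+2], at least 2 as [riemann_gt0] requires. *)
have UN : U N.+1 < T + d by apply: NU => /=.
have r0 (k : 'I_M.+1) : 0 < riemann R N.+2 k (M - k) by exact: riemann_gt0.
have Mq : (M < (M + K).+1)%N by rewrite ltnS leq_addr.
have [p [p1 p2 p3]] := @exists_hopf_sample R N.+2 _ w isT prim_w w1 M
  (fun v => \sum_(k < K) b k * v ^+ k.+1) Mq r0.
exists p; split=> //; apply: le_trans p3 _; apply: le_trans (ltW UN).
exact: (@grid_energy_le R N.+2 _ w).
Qed.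

Lemma cbr_small (R : realType) (e : R) : 0 < e -> exists K, cbr K.+1 <= e :> R.
Proof.
move=> e0; pose K := Num.truncn (e ^- 2); exists K.
have K1 : e ^- 2 <= K.+1%:R :> R by rewrite ltW // Num.Theory.truncnS_gt.
have e2 : 0 < e ^+ 2 by rewrite exprn_gt0.
rewrite -ler_sqr ?nnegrE ?(ltW e0) ?(ltW (cbr_gt0 _ _)) //.
have := @cbr_sqr_le R K.+1; set c := _ ^+ 2 => H.
have c0 : 0 <= c by rewrite sqr_ge0.
have : e ^- 2 * c <= 1.
  apply: le_trans H; rewrite ler_wpM2r // (le_trans K1) // ler_nat.
  by apply: leqW; rewrite -addnn leq_addr.
by rewrite ler_pdivrMl // mulr1.
Qed.

Lemma exists_hopf_log (R : realType) M (d : R) : 0 < d ->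
  exists p : 'I_M.+1 -> cplx R * cplx R,
  [/\ forall i, nsq (p i).1 + nsq (p i).2 = 1,
      forall i j, i != j -> nsq (hdot (p i) (p j)) < 1 &
      \sum_i \sum_(j | i != j) - ln (1 + Num.sqrt (1 - nsq (hdot (p i) (p j)))) <=
      - (M.+1%:R ^+ 2 / 2) + (2 * cbr M.+1)^-1 + d].
Proof.
move=> d0; pose m := M.+1%:R : R; have m0 : 0 < m by rewrite ltr0n.
have m2 : 0 < m ^+ 2 by rewrite exprn_gt0.
(* Half of [d] pays for the truncation of the series, the other half for the grid. *)
have [K cK] := @cbr_small R (d / 2 / m ^+ 2) (divr_gt0 (divr_gt0 d0 (ltr0n _ 2)) m2).
have {}cK : m ^+ 2 * cbr K.+1 <= d / 2 by rewrite mulrC -ler_pdivlMr.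
pose b (k : 'I_K) : R := cbr k.+1 / (2 * k.+1%:R).
have b0 k : 0 <= b k by rewrite divr_ge0 ?mulr_ge0 ?ltW ?cbr_gt0.
have d2 : 0 < d / 2 by rewrite divr_gt0.
have [p [p1 p2 p3]] := exists_hopf_config M b0 d2.
exists p; split=> //.
pose v i j := nsq (hdot (p i) (p j)).
have E1 : \sum_i \sum_(j | i != j) - ln (1 + Num.sqrt (1 - v i j)) <=
    \sum_i \sum_(j | i != j) (\sum_(k < K) b k * v i j ^+ k.+1 - \sum_k b k).
  apply: ler_sum => i _; apply: ler_sum => j ij.
  have v1 : 0 <= 1 - v i j by rewrite subr_ge0 ltW // p2.
  have y01 : 0 <= Num.sqrt (1 - v i j) <= 1.
    rewrite sqrtr_ge0 /= -[leRHS]sqrtr1 ler_wsqrtr // gerBl; exact: nsq_ge0.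
  apply: le_trans (ln_1D_ge K y01) _.
  rewrite sqr_sqrtr // -sumrB; apply: ler_sum => k _.
  by rewrite subKr mulrBr mulr1.
apply: le_trans E1 _.
have E2 : \sum_(i < M.+1) \sum_(j < M.+1 | i != j) (\sum_k b k) = m * (m - 1) * \sum_k b k.
  set B := \sum_k b k.
  rewrite (eq_bigr (fun _ : 'I_M.+1 => (m - 1) * B)).
    by rewrite sumr_const card_ord -[LHS]mulr_natl mulrA.
  move=> i _; have : \sum_(j < M.+1) B = m * B.
    by rewrite sumr_const card_ord -[LHS]mulr_natl.
  rewrite (bigD1 i) //= [X in B + X = _](eq_bigl (fun j => i != j)); last by move=> j; rewrite eq_sym.
  by lra.
have E3 : \sum_i \sum_(j | i != j) (\sum_(k < K) b k * v i j ^+ k.+1 - \sum_k b k) =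
   \sum_i \sum_(j | i != j) (\sum_(k < K) b k * v i j ^+ k.+1) - m * (m - 1) * \sum_k b k.
  by rewrite -E2 -sumrB; apply: eq_bigr => i _; rewrite sumrB.
rewrite E3.
have := @sum_cbr_energy_le R M.+1 K isT.
have -> : \sum_(k < K) cbr k.+1 / (2 * k.+1%:R) *
     (m ^+ 2 * (k.+2%:R^-1 - (k.+1 + M.+1)%:R^-1) - m * (m - 1)) =
   m ^+ 2 * (\sum_(k < K) b k * (k.+2%:R^-1 - (k.+1 + M.+1)%:R^-1)) -
   m * (m - 1) * \sum_k b k.
  rewrite !mulr_sumr -sumrB; apply: eq_bigr => k _; rewrite -/(b k).
  by rewrite mulrBr; congr (_ - _); [exact: mulrCA|exact: mulrC].
by move: p3; rewrite -/m; lra.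
Qed.

(** * Equally spaced points on the fibres *)

Lemma ln_prod (R : realType) (I : finType) (P : pred I) (F : I -> R) :
  (forall i, P i -> 0 < F i) -> ln (\prod_(i | P i) F i) = \sum_(i | P i) ln (F i).
Proof.
move=> F0; elim: (index_enum I) => [|i s IHs]; first by rewrite !big_nil ln1.
rewrite !big_cons; case: ifP => // Pi.
by rewrite lnM ?IHs // posrE; [exact: F0|exact: prodr_gt0].
Qed.

Lemma prod_1B_prim_root (F : fieldType) Q (z x : F) : Q.-primitive_root z ->
  \prod_(a < Q) (1 - z ^+ a * x) = 1 - x ^+ Q.
Proof.
move=> prim_z; have Q0 := prim_order_gt0 prim_z.
have [->|x0] := eqVneq x 0.
  rewrite expr0n gtn_eqF // subr0 big1 // => a _; by rewrite mulr0 subr0.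
have := congr1 (fun p => p.[x^-1]) (factor_Xn_sub_1 prim_z).
rewrite big_mkord horner_prod hornerD hornerN hornerXn hornerC => E.
transitivity (x ^+ Q * (x^-1 ^+ Q - 1)); last first.
  by rewrite mulrBr mulr1 -exprMn mulfV // expr1n.
rewrite -E -[in X in X * _](card_ord Q) -prodr_const -big_split /=.
apply: eq_bigr => a _; rewrite hornerXsubC mulrBr mulfV //.
by rewrite mulrC.
Qed.

(** Both sides are the derivative of [X^r - 1] at the root [z ^+ k]. *)
Lemma prod_prim_rootB (F : fieldType) r (z : F) (k : 'I_r) : r.-primitive_root z ->
  \prod_(l < r | l != k) (z ^+ k - z ^+ l) = r%:R * (z ^+ k) ^+ r.-1.
Proof.
move=> prim_z.
have := congr1 (fun p => p^`().[z ^+ k]) (factor_Xn_sub_1 prim_z).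
rewrite big_mkord (bigD1 k) //= derivM hornerD !hornerM derivXsubC hornerC mul1r.
rewrite hornerXsubC subrr mul0r addr0 derivB derivC subr0 derivXn hornerMn hornerXn.
rewrite -mulr_natl => <-; rewrite horner_prod; apply: eq_bigr => l _.
by rewrite hornerXsubC.
Qed.

Section Fibres.
Variable R : realType.
Implicit Types p : cplx R * cplx R.

Definition dist2 p p' := nsq (p.1 - p'.1) + nsq (p.2 - p'.2).

Definition crot (c : cplx R) p := (c * p.1, c * p.2).

Lemma dist2_crot (c c' : cplx R) p p' : nsq c = 1 -> nsq c' = 1 ->
  nsq p.1 + nsq p.2 = 1 -> nsq p'.1 + nsq p'.2 = 1 ->
  dist2 (crot c p) (crot c' p') = 2 - 2 * cre (c * conjc c' * hdot p p').
Proof.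
move=> c1 c1' p1 p1'.
have -> : dist2 (crot c p) (crot c' p') =
  nsq (c * p.1 - c' * p'.1) + nsq (c * p.2 - c' * p'.2) by [].
rewrite !nsqB !nsqM c1 c1' !mul1r.
have -> : cre (c * conjc c' * hdot p p') =
    cre (c * p.1 * conjc (c' * p'.1)) + cre (c * p.2 * conjc (c' * p'.2)).
  rewrite -(raddfD (@cre R)); congr cre.
  by rewrite (conjcM c' p'.1) (conjcM c' p'.2) (mulrACA c p.1) (mulrACA c p.2) -mulrDr.
by lra.
Qed.

Lemma dist2_crot_same (c c' : cplx R) p : nsq p.1 + nsq p.2 = 1 ->
  dist2 (crot c p) (crot c' p) = nsq (c - c').
Proof.
by move=> p1; rewrite /dist2 /crot /= -!mulrBl !nsqM -mulrDr p1 mulr1.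
Qed.

(** The real part of [z] is at most [sqrt s], hence at most [(1 + s) / 2]. *)
Lemma nsq_1B_ge (z : cplx R) (s : R) : nsq z <= s -> s < 1 -> ((1 - s) / 2) ^+ 2 <= nsq (1 - z).
Proof.
case: z => x y; rewrite /nsq /= add0r sqrrN => zs s1.
have x2 : x ^+ 2 <= s by rewrite (le_trans _ zs) // lerDl sqr_ge0.
have x1 : `|x| < 1.
  by rewrite -(@expr_lt1 _ 2) ?normr_ge0 // real_normK ?num_real // (le_lt_trans x2).
have /andP[xl xr] : -1 < x < 1 by rewrite -ltr_norml.
apply: le_trans (_ : (1 - x) ^+ 2 <= _); last by rewrite lerDl sqr_ge0.
rewrite ler_sqr ?nnegrE; nra.
Qed.

(* With [y = sqrt (1 - |h|^2)] and [g = h / (1 + y)] one has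
   [2 - 2 Re (c h) = (1 + y) |1 - c g|^2] and [|g| < 1]. *)
Lemma mean_log_dist2 (h : cplx R) : nsq h < 1 -> exists2 D, 0 <= D &
  forall Q (z c : cplx R), Q.-primitive_root z -> nsq z = 1 -> nsq c = 1 ->
  \sum_(a < Q) - ln (2 - 2 * cre (z ^+ a * c * h)) <=
  Q%:R * (- ln (1 + Num.sqrt (1 - nsq h))) + D.
Proof.
move=> h1; set y := Num.sqrt _.
have v0 : 0 < 1 - nsq h by rewrite subr_gt0.
have y0 : 0 < y by rewrite sqrtr_gt0.
have y2 : y ^+ 2 = 1 - nsq h by rewrite sqr_sqrtr // ltW.
have y1 : y <= 1.
  by rewrite -[leRHS]sqrtr1 ler_wsqrtr // gerBl nsq_ge0.
have y10 : 0 < 1 + y by lra.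
pose g := rc (1 + y)^-1 * h; pose s := (1 - y) / (1 + y).
have gs : nsq g = s.
  rewrite /g nsqM nsq_rc /s; have := mulfV (lt0r_neq0 y10); set t := _^-1 => tE.
  have -> : nsq h = (1 - y) * (1 + y) by rewrite -[RHS]addr0; lra.
  transitivity ((1 - y) * t * ((1 + y) * t)); first by lra.
  by rewrite tE mulr1.
have hg : h = rc (1 + y) * g.
  by rewrite /g mulrA -rcM mulfV ?gt_eqF // rmorph1 mul1r.
clearbody g.
have s0 : 0 <= s by rewrite divr_ge0 ?subr_ge0 // ltW.
have s1 : s < 1 by rewrite ltr_pdivrMr //; lra.
(* The product over the roots of unity leaves [1 - (c g)^Q], whose squared modulus is at least
   [kappa] for all [Q] and [c]; the constant [D] is therefore uniform, and the mean is off by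
   [D / Q] only. *)
pose kappa := ((1 - s) / 2) ^+ 2.
have k0 : 0 < kappa by rewrite exprn_gt0 // divr_gt0 // subr_gt0.
have k1 : kappa <= 1 by rewrite exprn_ile1 ?divr_ge0 //; lra.
exists (- ln kappa) => [|Q z c prim_z z1 c1]; first by rewrite oppr_ge0 ln_le0.
have Q0 := prim_order_gt0 prim_z.
have E (a : 'I_Q) : 2 - 2 * cre (z ^+ a * c * h) = (1 + y) * nsq (1 - z ^+ a * (c * g)).
  have -> : cre (z ^+ a * c * h) = (1 + y) * cre (conjc (z ^+ a * (c * g))).
    rewrite -[cre (conjc _)]/(cre (z ^+ a * (c * g))) -cre_rcM hg; congr cre.
    by rewrite [LHS]mulrCA -[z ^+ a * c * g]mulrA.
  rewrite nsqB nsq1 mul1r !nsqM nsqX z1 c1 expr1n !mul1r gs /s.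
  have := mulfV (lt0r_neq0 y10); set t := _^-1 => tE.
  move: (cre _) => x.
  transitivity (1 + y + (1 - y) * ((1 + y) * t) - 2 * ((1 + y) * x)); last by lra.
  by rewrite tE; lra.
have pos (a : 'I_Q) : 0 < nsq (1 - z ^+ a * (c * g)).
  apply: lt_le_trans (nsq_1B_ge (_ : nsq (z ^+ a * (c * g)) <= s) s1); first exact: k0.
  by rewrite !nsqM nsqX z1 c1 expr1n !mul1r gs.
rewrite sumrN.
have -> : \sum_(a < Q) ln (2 - 2 * cre (z ^+ a * c * h)) =
   Q%:R * ln (1 + y) + ln (nsq (1 - (c * g) ^+ Q)).
  rewrite -(prod_1B_prim_root (c * g) prim_z) nsq_prod ln_prod; last by move=> a _; exact: pos.
  rewrite -[X in X%:R * _](card_ord Q) mulr_natl -sumr_const -big_split /=.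
  by apply: eq_bigr => a _; rewrite E lnM // posrE.
rewrite mulrN opprD lerD2l lerN2 ler_ln ?posrE //.
  apply: (nsq_1B_ge _ s1); rewrite nsqX nsqM c1 mul1r gs.
  by have := ler_wiXn2l s0 (ltW s1) Q0; rewrite expr1.
by rewrite -(prod_1B_prim_root (c * g) prim_z) nsq_prod prodr_gt0.
Qed.

End Fibres.

Lemma exists_le_mean (R : realType) (I : finType) (F : I -> R) (T : R) : (0 < #|I|)%N ->
  \sum_i F i <= #|I|%:R * T -> exists i, F i <= T.
Proof.
move=> I0 FT; apply: contrapT => H.
have FT' i : T < F i by rewrite ltNge; apply/negP => Fi; apply: H; exists i.
have /card_gt0P[i0 _] := I0.
move: FT; rewrite leNgt => /negP; apply.
rewrite mulr_natl -sumr_const (bigD1 i0) //= [ltRHS](bigD1 i0) //=.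
by rewrite ltr_leD // ler_sum // => i _; exact: ltW.
Qed.

(** First-moment argument over independent phases: [sum_ffun_pair] reduces the mean of each term to
    the two phases involved, and averaging one of them is enough. *)
Lemma exists_phases (R : realType) m Q (G : 'I_m -> 'I_m -> 'I_Q -> 'I_Q -> R)
    (g : 'I_m -> 'I_m -> R) : (0 < Q)%N ->
  (forall i j, i != j -> forall b, \sum_a G i j a b <= Q%:R * g i j) ->
  exists x : {ffun 'I_m -> 'I_Q},
    \sum_i \sum_(j | i != j) G i j (x i) (x j) <= \sum_i \sum_(j | i != j) g i j.
Proof.
move=> Q0 Gg; apply: exists_le_mean.
  by rewrite card_ffun !card_ord expn_gt0 Q0.
rewrite card_ffun !card_ord natrX exchange_big /= mulr_sumr; apply: ler_sum => i _.
rewrite exchange_big /= mulr_sumr; apply: ler_sum => j ij.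
have -> : \sum_(x : {ffun 'I_m -> 'I_Q}) G i j (x i) (x j) =
    \sum_(x : {ffun 'I_m -> 'I_Q}) G i j (x i) (x j) * \prod_(k < m) 1.
  by apply: eq_bigr => x _; rewrite big1 ?mulr1.
rewrite (sum_ffun_pair (fun _ _ => 1) (G i j) ij).
have q1 : \sum_(z < Q) 1 = Q%:R :> R by rewrite sumr_const card_ord.
have -> : Q%:R ^+ m = (\prod_(k < m | (k != i) && (k != j)) \sum_(z < Q) 1) * (Q%:R * Q%:R) :> R.
  rewrite -[X in _ ^+ X](card_ord m) -prodr_const (bigD1 i) //= (bigD1 j) 1?eq_sym //=.
  by rewrite q1 mulrA [RHS]mulrC.
rewrite -!mulrA; apply: ler_wpM2l; first by rewrite prodr_ge0 // => k _; rewrite q1.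
rewrite exchange_big /=.
have -> : Q%:R * (Q%:R * g i j) = \sum_(b < Q) Q%:R * g i j.
  by rewrite sumr_const card_ord mulr_natl.
apply: ler_sum => b _.
by under eq_bigr do rewrite !mulr1; exact: Gg.
Qed.

(** The distances from one [r]-th root of unity to the others multiply to [r]. *)
Lemma sum_log_roots (R : realType) r (z : cplx R) : r.-primitive_root z -> nsq z = 1 ->
  \sum_(k < r) \sum_(l < r | k != l) - ln (nsq (z ^+ k - z ^+ l)) = - (2 * r%:R * ln r%:R).
Proof.
move=> prim_z z1; have r0 := prim_order_gt0 prim_z.
have rR : 0 < r%:R :> R by rewrite ltr0n.
rewrite (eq_bigr (fun _ : 'I_r => - (2 * ln r%:R))).
  by rewrite sumr_const card_ord -[LHS]mulr_natl; lra.
move=> k _; rewrite sumrN (eq_bigl (fun l => l != k)); last by move=> l; rewrite eq_sym.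
rewrite -ln_prod; last first.
  move=> l lk; rewrite lt_neqAle nsq_ge0 andbT eq_sym nsq_eq0 subr_eq0.
  by rewrite (eq_prim_root_expr prim_z) !modn_small // eq_sym (inj_eq val_inj).
have -> : \prod_(l < r | l != k) nsq (z ^+ k - z ^+ l) = r%:R ^+ 2.
  rewrite -(big_morph _ (@nsqM R) (@nsq1 R)) (prod_prim_rootB k prim_z) nsqM !nsqX z1.
  by rewrite !expr1n mulr1 -(rmorph_nat (@rc R)) nsq_rc.
by rewrite lnXn // mulr_natl.
Qed.

Lemma cre_lt1 (R : realType) (z : cplx R) : nsq z < 1 -> cre z < 1.
Proof.
rewrite /nsq => z1; rewrite ltNge; apply/negP => c1.
have : 0 <= cim z ^+ 2 by rewrite sqr_ge0.
by nra.
Qed.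

Lemma exists_fibre_config (R : realType) m r (p : 'I_m -> cplx R * cplx R) (d : R) :
  (0 < r)%N -> 0 < d ->
  (forall i, nsq (p i).1 + nsq (p i).2 = 1) ->
  (forall i j, i != j -> nsq (hdot (p i) (p j)) < 1) ->
  exists P : 'I_m * 'I_r -> cplx R * cplx R,
  [/\ forall a, nsq (P a).1 + nsq (P a).2 = 1,
      forall a b, a != b -> 0 < dist2 (P a) (P b) &
      \sum_a \sum_(b | a != b) - ln (dist2 (P a) (P b)) <=
      - (2 * (m%:R * r%:R) * ln r%:R) +
      r%:R ^+ 2 * (\sum_i \sum_(j | i != j)
         - ln (1 + Num.sqrt (1 - nsq (hdot (p i) (p j))))) + d].
Proof.
move=> r0 d0 p1 p2.
have HD (ij : 'I_m * 'I_m) : exists D : R, 0 <= D /\ (ij.1 != ij.2 ->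
    forall Q (z c : cplx R), Q.-primitive_root z -> nsq z = 1 -> nsq c = 1 ->
    \sum_(a < Q) - ln (2 - 2 * cre (z ^+ a * c * hdot (p ij.1) (p ij.2))) <=
    Q%:R * (- ln (1 + Num.sqrt (1 - nsq (hdot (p ij.1) (p ij.2))))) + D).
  have [->|ij12] := eqVneq ij.1 ij.2; first by exists 0.
  by have [D D0 HD] := mean_log_dist2 (p2 _ _ ij12); exists D.
have [D {}HD] := choice HD.
have D0 i j : 0 <= D (i, j) by have [] := HD (i, j).
pose S : R := r%:R ^+ 2 * \sum_i \sum_(j | i != j) D (i, j).
(* [Q] is a multiple of [r], so that the points of a fibre and its rotations are all powers of one
   root [z], and is large enough for the total averaging error [S / Q] to be at most [d]. *)
pose q := (Num.truncn (S / d)).+1.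
pose Q := (r * q)%N.
have Q0 : (0 < Q)%N by rewrite muln_gt0 r0.
have QR : 0 < Q%:R :> R by rewrite ltr0n.
have SQ : S / Q%:R <= d.
  rewrite ler_pdivrMr // mulrC -ler_pdivrMr // (le_trans (ltW (Num.Theory.truncnS_gt _))) //.
  by rewrite ler_nat /Q leq_pmull.
have [z [prim_z z1]] := @cplx_prim_root R Q Q0.
have zn1 n : nsq (z ^+ n) = 1 by rewrite nsqX z1 expr1n.
pose c (a k : nat) : cplx R := z ^+ (a + q * k).
have c1 a k : nsq (c a k) = 1 by exact: zn1.
pose G (i j : 'I_m) (a b : 'I_Q) := \sum_(k < r) \sum_(l < r)
  - ln (dist2 (crot (c a k) (p i)) (crot (c b l) (p j))).
pose g (i j : 'I_m) := r%:R ^+ 2 * (- ln (1 + Num.sqrt (1 - nsq (hdot (p i) (p j)))) + D (i, j) / Q%:R).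
have Gg i j : i != j -> forall b, \sum_a G i j a b <= Q%:R * g i j.
  move=> ij b; rewrite /G exchange_big /=.
  have [_ /(_ ij) H] := HD (i, j); cbn [fst snd] in H.
  have -> : Q%:R * g i j = \sum_(k < r) \sum_(l < r)
      (Q%:R * (- ln (1 + Num.sqrt (1 - nsq (hdot (p i) (p j))))) + D (i, j)).
    rewrite !sumr_const !card_ord -mulrnA -[RHS]mulr_natl natrM /g.
    rewrite mulrCA -expr2; congr (_ * _); rewrite mulrDr; congr (_ + _).
    by rewrite mulrC divfK // gt_eqF.
  apply: ler_sum => k _; rewrite exchange_big /=; apply: ler_sum => l _.
  (* The positions [k] and [l] and the phase [b] merge into the constant [c]; only the phase [a] is
     averaged. *)
  have := H Q z (z ^+ (q * k) * conjc (c b l)) prim_z z1.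
  rewrite nsqM nsq_conjc !zn1 mulr1 => /(_ erefl); apply: le_trans.
  apply: ler_sum => a _; rewrite dist2_crot ?c1 //.
  have -> : c a k = z ^+ a * z ^+ (q * k) by exact: exprD.
  by rewrite (mulrA (z ^+ a)).
have [x Hx] := exists_phases Q0 Gg.
pose eta := z ^+ q.
have prim_eta : r.-primitive_root eta.
  have q0 : (0 < q)%N by [].
  have E : (Q %/ gcdn q Q)%N = r by rewrite /Q gcdnMl mulnK.
  by have := exp_prim_root prim_z q; rewrite E.
have nsq_c a k l : nsq (c a k - c a l) = nsq (eta ^+ k - eta ^+ l).
  have cE n : c a n = z ^+ a * eta ^+ n by rewrite /c exprD exprM.
  by rewrite !cE -mulrBr nsqM zn1 mul1r.
have nsq_eta (k l : 'I_r) : k != l -> 0 < nsq (eta ^+ k - eta ^+ l).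
  move=> kl; rewrite lt_neqAle nsq_ge0 andbT eq_sym nsq_eq0 subr_eq0.
  by rewrite (eq_prim_root_expr prim_eta) !modn_small.
exists (fun a : 'I_m * 'I_r => crot (c (x a.1) a.2) (p a.1)); split.
- by move=> a; rewrite /crot /= !nsqM zn1 !mul1r.
- move=> [i k] [j l] ab /=; have [ij|ij] := eqVneq i j; last first.
    rewrite dist2_crot ?c1 //; set w := _ * hdot _ _.
    have /cre_lt1 : nsq w < 1 by rewrite /w nsqM nsqM nsq_conjc !zn1 !mul1r p2.
    lra.
  rewrite -ij dist2_crot_same // nsq_c; apply: nsq_eta.
  by apply: contraNneq ab => ->; rewrite ij.
have E (a : 'I_m * 'I_r) : \sum_(b | a != b) - ln (dist2 (crot (c (x a.1) a.2) (p a.1)) (crot (c (x b.1) b.2) (p b.1))) =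
    \sum_(l < r | a.2 != l) - ln (nsq (eta ^+ a.2 - eta ^+ l)) +
    \sum_(j | a.1 != j) \sum_(l < r)
       - ln (dist2 (crot (c (x a.1) a.2) (p a.1)) (crot (c (x j) l) (p j))).
  case: a => i k /=.
  transitivity (\sum_j \sum_(l | (i, k) != (j, l))
     - ln (dist2 (crot (c (x i) k) (p i)) (crot (c (x j) l) (p j)))).
    by rewrite pair_big_dep.
  rewrite (bigD1 i) //=; congr (_ + _).
    apply: eq_big => [l|l _]; first by rewrite xpair_eqE eqxx.
    by rewrite dist2_crot_same // nsq_c.
  apply: eq_big => [j|j ij]; first by rewrite eq_sym.
  by apply: eq_bigl => l; rewrite xpair_eqE eq_sym (negbTE ij).
rewrite (eq_bigr _ (fun a _ => E a)) big_split /=.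
have -> : \sum_(a : 'I_m * 'I_r) \sum_(l < r | a.2 != l) - ln (nsq (eta ^+ a.2 - eta ^+ l)) =
    - (2 * (m%:R * r%:R) * ln r%:R).
  rewrite -(pair_bigA _ (fun (i : 'I_m) (k : 'I_r) => \sum_(l < r | k != l) - ln (nsq (eta ^+ k - eta ^+ l)))) /=.
  rewrite (eq_bigr _ (fun i _ => sum_log_roots prim_eta (zn1 q))).
  by rewrite sumr_const card_ord -[LHS]mulr_natl; lra.
rewrite -addrA lerD2l.
have -> : \sum_(a : 'I_m * 'I_r) \sum_(j | a.1 != j) \sum_(l < r)
     - ln (dist2 (crot (c (x a.1) a.2) (p a.1)) (crot (c (x j) l) (p j))) =
   \sum_i \sum_(j | i != j) G i j (x i) (x j).
  rewrite -(pair_bigA _ (fun (i : 'I_m) (k : 'I_r) => \sum_(j | i != j) \sum_(l < r)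
     - ln (dist2 (crot (c (x i) k) (p i)) (crot (c (x j) l) (p j))))) /=.
  by apply: eq_bigr => i _; rewrite exchange_big.
apply: (le_trans Hx).
have -> : \sum_i \sum_(j | i != j) g i j = r%:R ^+ 2 * (\sum_i \sum_(j | i != j)
         - ln (1 + Num.sqrt (1 - nsq (hdot (p i) (p j))))) + S / Q%:R.
  rewrite /S mulr_sumr mulr_sumr mulr_suml -big_split /=; apply: eq_bigr => i _.
  rewrite mulr_sumr mulr_sumr mulr_suml -big_split /=; apply: eq_bigr => j _.
  by rewrite /g mulrDr mulrA.
by rewrite lerD2l.
Qed.

(** * Transfer to the unit sphere of [R^4] *)

Definition row_of_pair (R : realType) (p : cplx R * cplx R) : 'rV[R]_4 :=
  \row_(k < 4) [:: cre p.1; cim p.1; cre p.2; cim p.2]`_k.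

Lemma enorm_row_of_pair (R : realType) (p : cplx R * cplx R) :
  enorm (row_of_pair p) = Num.sqrt (nsq p.1 + nsq p.2).
Proof.
rewrite /enorm !big_ord_recl big_ord0 !mxE /= addr0.
by rewrite /nsq !addrA.
Qed.

Lemma enorm_row_of_pairB (R : realType) (p p' : cplx R * cplx R) :
  enorm (row_of_pair p - row_of_pair p') = Num.sqrt (dist2 p p').
Proof.
have -> : row_of_pair p - row_of_pair p' = row_of_pair (p.1 - p'.1, p.2 - p'.2).
  by apply/rowP => k; rewrite !mxE; case: k => -[|[|[|[|//]]]].
exact: enorm_row_of_pair.
Qed.

Lemma ln_1div_sqrt (R : realType) (d : R) : 0 < d -> ln (1 / Num.sqrt d) = - ln d / 2.
Proof.
move=> d0; have s0 : 0 < Num.sqrt d by rewrite sqrtr_gt0.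
rewrite div1r lnV ?posrE // -[in RHS](sqr_sqrtr (ltW d0)) lnXn // mulr2n; lra.
Qed.

Lemma exists_low_log_energy (R : realType) M r : (0 < r)%N ->
  exists2 x : 'I_(M.+1 * r) -> 'rV[R]_4, @sphere_config R _ x &
  log_energy x <= - ((M.+1 * r)%:R ^+ 2 / 4) - (M.+1 * r)%:R * ln r%:R +
    r%:R ^+ 2 / (4 * cbr M.+1) + 1.
Proof.
move=> r0; have rR : 0 < r%:R ^+ 2 :> R by rewrite exprn_gt0 // ltr0n.
(* This error becomes 1 after multiplication by [r^2]; with the 1 spent in [exists_fibre_config],
   and halving because squared distances are used, the total is the final [+ 1]. *)
have d0 : 0 < (r%:R ^+ 2)^-1 :> R by rewrite invr_gt0.
have [p [p1 p2 p3]] := @exists_hopf_log R M _ d0.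
have [P [P1 P2 P3]] := exists_fibre_config r0 (@ltr01 R) p1 p2.
have E : #|{: 'I_M.+1 * 'I_r}| = (M.+1 * r)%N by rewrite card_prod !card_ord.
pose f (i : 'I_(M.+1 * r)) : 'I_M.+1 * 'I_r := enum_val (cast_ord (esym E) i).
have f_bij : bijective f.
  exists (fun a => cast_ord E (enum_rank a)) => [i|a].
    by rewrite /f enum_valK cast_ordKV.
  by rewrite /f cast_ordK enum_rankK.
have f_inj := bij_inj f_bij.
exists (fun i => row_of_pair (P (f i))).
  split=> [i j Pij|i]; last by rewrite /sphere3 /= enorm_row_of_pair P1 sqrtr1.
  apply: contrapT => /eqP ij.
  have /P2 : f i != f j by rewrite (inj_eq f_inj).
  rewrite -sqrtr_gt0 -enorm_row_of_pairB Pij subrr /enorm big1 ?sqrtr0 ?ltxx //.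
  by move=> k _; rewrite mxE expr0n.
have -> : log_energy (fun i => row_of_pair (P (f i))) =
    (\sum_a \sum_(b | a != b) - ln (dist2 (P a) (P b))) / 2.
  rewrite mulr_suml (reindex f) /=; last exact: onW_bij.
  apply: eq_bigr => i _; rewrite mulr_suml (reindex f) /=; last exact: onW_bij.
  apply: eq_big => [j|j ij]; first by rewrite (inj_eq f_inj).
  by rewrite enorm_row_of_pairB ln_1div_sqrt // P2 // (inj_eq f_inj).
rewrite ler_pdivrMr //; apply: (le_trans P3).
have := ler_wpM2l (ltW rR) p3; rewrite mulrDr mulfV ?gt_eqF // natrM.
rewrite !invfM; have := cbr_gt0 R M.+1; set c := (cbr M.+1)^-1.
set A := \sum_i _; move=> _ H.
have : r%:R ^+ 2 * (2^-1 * c) = (r%:R ^+ 2 * (4^-1 * c)) * 2 :> R by lra.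
rewrite mulrDl; lra.
Qed.

(** * Existence of minimisers *)

Section MinimumExists.
Variables (R : realType) (N : nat).

(** Configurations are flattened to a single row vector so that compactness and the extreme value
    theorem for row vectors apply. *)
Definition point_of (u : 'rV[R]_(N * 4)) (i : 'I_N) : 'rV[R]_4 := row i (vec_mx u).

Definition sqdist (u : 'rV[R]_(N * 4)) i j : R :=
  \sum_(k < 4) (point_of u i 0 k - point_of u j 0 k) ^+ 2.

Lemma enormB_sqdist u i j : enorm (point_of u i - point_of u j) = Num.sqrt (sqdist u i j).
Proof. by rewrite /enorm; congr Num.sqrt; apply: eq_bigr => k _; rewrite !mxE. Qed.

Lemma continuous_point_of i k : continuous (fun u : 'rV[R]_(N * 4) => point_of u i 0 k).
Proof.
move=> u; rewrite /point_of.
under [X in continuous_at _ X]eq_fun do rewrite !mxE.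
exact: coord_continuous.
Qed.

Lemma continuous_fin_sum (T : topologicalType) (I : finType) (P : pred I) (F : I -> T -> R) :
  (forall i, continuous (F i)) -> continuous (fun t => \sum_(i | P i) F i t).
Proof.
move=> cF t; elim: (index_enum I) => [|i s IHs].
  under [X in continuous_at _ X]eq_fun do rewrite big_nil.
  exact: cst_continuous.
under [X in continuous_at _ X]eq_fun do rewrite big_cons.
case: (P i) => //; exact: continuousD (cF i t) IHs.
Qed.

Lemma continuous_fin_prod (T : topologicalType) (I : finType) (P : pred I) (F : I -> T -> R) :
  (forall i, continuous (F i)) -> continuous (fun t => \prod_(i | P i) F i t).
Proof.
move=> cF t; elim: (index_enum I) => [|i s IHs].
  under [X in continuous_at _ X]eq_fun do rewrite big_nil.
  exact: cst_continuous.
under [X in continuous_at _ X]eq_fun do rewrite big_cons.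
case: (P i) => //; exact: continuousM (cF i t) IHs.
Qed.

Lemma continuous_sqr (T : topologicalType) (f : T -> R) :
  continuous f -> continuous (fun t => f t ^+ 2).
Proof.
move=> cf t; under [X in continuous_at _ X]eq_fun do rewrite expr2.
exact: continuousM (cf t) (cf t).
Qed.

Lemma continuous_sqdist i j : continuous (fun u => sqdist u i j).
Proof.
apply: continuous_fin_sum => k; apply: continuous_sqr => u.
apply: continuousB; exact: continuous_point_of.
Qed.

(** The energy takes wrong values at coincident points, as [ln 0 = 0]. One maximises instead [Phi],
    the product of squared distances, continuous on a compact set; its maximum is positive because
    of [x0], so the maximiser is injective, and there the energy is [- ln Phi / 2]. *)
Lemma min_log_energy_exists (x0 : 'I_N -> 'rV[R]_4) : @sphere_config R N x0 ->
  exists m : R, is_min_log_energy N m.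
Proof.
move=> x0S.
pose A : set 'rV[R]_(N * 4) := [set u | forall i, \sum_(k < 4) point_of u i 0 k ^+ 2 = 1].
pose Phi u := \prod_i \prod_(j | i != j) sqdist u i j.
pose code (x : 'I_N -> 'rV[R]_4) : 'rV[R]_(N * 4) := mxvec (\matrix_i x i).
have codeK x i : point_of (code x) i = x i.
  by rewrite /point_of /code mxvecK rowK.
have codeA x : @sphere_config R N x -> A (code x).
  move=> [_ xS] i; rewrite codeK; have := xS i; rewrite /sphere3 /= /enorm => x1.
  rewrite -[LHS]sqr_sqrtr ?x1 ?expr1n // sumr_ge0 // => k _; exact: sqr_ge0.
have energyE u : injective (point_of u) -> 0 < Phi u /\
    log_energy (point_of u) = - ln (Phi u) / 2.
  move=> u_inj.
  have d0 i j : i != j -> 0 < sqdist u i j.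
    move=> ij; rewrite lt_neqAle sumr_ge0 ?andbT; last by move=> k _; exact: sqr_ge0.
    apply: contra ij => /eqP/esym/psumr_eq0P d0; apply/eqP/u_inj/rowP => k.
    apply/eqP; rewrite -subr_eq0 -sqrf_eq0 d0 // => l _; exact: sqr_ge0.
  split; first by rewrite prodr_gt0 // => i _; rewrite prodr_gt0 // => j; exact: d0.
  rewrite ln_prod; last by move=> i _; rewrite prodr_gt0 // => j; exact: d0.
  rewrite -sumrN mulr_suml; apply: eq_bigr => i _.
  rewrite ln_prod; last by move=> j; exact: d0.
  rewrite -sumrN mulr_suml; apply: eq_bigr => j ij.
  by rewrite enormB_sqdist ln_1div_sqrt // d0.
have A_closed : closed A.
  have -> : A = \bigcap_(i in [set: 'I_N])
      ((fun u => \sum_(k < 4) point_of u i 0 k ^+ 2) @^-1` [set 1]).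
    by apply/seteqP; split => u Au i; [move=> _|]; apply: Au.
  apply: closed_bigI => i _; apply: closed_comp; last exact: closed_eq.
  move=> u _; apply: continuous_fin_sum => k; apply: continuous_sqr; exact: continuous_point_of.
have A_compact : compact A.
  have box : compact [set v : 'rV[R]_(N * 4) | forall l, v ord0 l \in `[(-1 : R), 1]%R].
    apply: (@rV_compact _ _ (fun=> `[(-1 : R), 1]%classic)) => _; exact: segment_compact.
  apply: subclosed_compact A_closed box _ => u uA l.
  case/mxvec_indexP: l => i k.
  have -> : u ord0 (mxvec_index i k) = point_of u i 0 k by rewrite !mxE.
  rewrite in_itv /= -ler_norml -(@ler_sqr R) ?nnegrE ?normr_ge0 // real_normK ?num_real //.
  by rewrite expr1n -(uA i) (bigD1 k) //= lerDl sumr_ge0 // => k' _; exact: sqr_ge0.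
have Phi_cont : continuous Phi.
  by apply: continuous_fin_prod => i; apply: continuous_fin_prod => j; exact: continuous_sqdist.
have A0 : A !=set0 by exists (code x0); exact: codeA.
have [c /set_mem cA cmax] := EVT_max_rV A0 A_compact (continuous_subspaceT Phi_cont).
have code_inj x : @sphere_config R N x -> injective (point_of (code x)).
  by move=> [x_inj _] i j; rewrite !codeK => /x_inj.
have Phi_pos : 0 < Phi c.
  have [P0 _] := energyE _ (code_inj _ x0S).
  by apply: lt_le_trans P0 _; apply: cmax; apply/mem_set; exact: codeA.
have c_inj : injective (point_of c).
  move=> i j cij; apply: contrapT => /eqP ij; move: Phi_pos.
  rewrite /Phi (bigD1 i) //= (bigD1 j) //= (_ : sqdist c i j = 0) ?mul0r ?mul0r ?ltxx //.
  by rewrite /sqdist cij big1 // => k _; rewrite subrr expr0n.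
exists (log_energy (point_of c)); split.
  exists (point_of c) => //; split=> // i; rewrite /sphere3 /= /enorm.
  by rewrite cA sqrtr1.
move=> _ [x xS <-].
have [P0 xE] := energyE _ (code_inj _ xS).
have -> : log_energy x = log_energy (point_of (code x)).
  by congr log_energy; apply/funext => i; rewrite codeK.
have [_ ->] := energyE _ c_inj; rewrite xE ler_wpM2r ?invr_ge0 //.
rewrite lerN2 ler_ln ?posrE //; apply: cmax; apply/mem_set; exact: codeA.
Qed.

End MinimumExists.

(** * Choice of the number of points per fibre *)

(* With [r = rho * sqrt m], the coefficient of [n] in the energy is
   [- 2 / 3 * ln rho + sqrt pi / 4 * rho], which is least at this [rho]. *)
Definition fibre_ratio (R : realType) : R := 8 / (3 * Num.sqrt pi).

(** The number of fibres will be [i.+1 ^ 2], so [i.+1] stands for [sqrt m]; the successor keeps the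
    size positive. *)
Definition fibre_size (R : realType) (i : nat) : nat :=
  (Num.truncn (fibre_ratio R * i.+1%:R)).+1.

Lemma fibre_ratio_gt0 (R : realType) : 0 < fibre_ratio R.
Proof. by rewrite divr_gt0 // mulr_gt0 // sqrtr_gt0 pi_gt0. Qed.

Lemma cvg_fibre_size (R : realType) :
  (fibre_size R i)%:R / i.+1%:R @[i --> \oo] --> fibre_ratio R.
Proof.
have k0 := fibre_ratio_gt0 R; set k := fibre_ratio R in k0 *.
apply: (@squeeze_cvgr _ _ _ _ (fun _ => k) (fun i => k + i.+1%:R^-1)).
- near=> i; have s0 : 0 < i.+1%:R :> R by rewrite ltr0n.
  have ks : 0 <= k * i.+1%:R by rewrite mulr_ge0 // ltW.
  rewrite /fibre_size -/k ler_pdivlMr // (ltW (Num.Theory.truncnS_gt _)) /=.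
  by rewrite ler_pdivrMr // mulrDl mulVf ?gt_eqF // mulrSr lerD2r Num.Theory.truncn_le.
- exact: cvg_cst.
- rewrite -[X in _ --> X]addr0; apply: cvgD; first exact: cvg_cst.
  exact: cvg_harmonic.
Unshelve. all: by end_near.
Qed.

(** A bound for the excess of the energy over the target, divided by [n]. The square root is the
    Wallis bound for [1 / (c_m sqrt m)] and tends to [sqrt pi]; the last summand absorbs the
    additive 1. *)
Definition energy_error (R : realType) (i : nat) : R :=
  let rho := (fibre_size R i)%:R / i.+1%:R in
  - (2 / 3 * ln rho) - C_S R
  + rho * Num.sqrt (pi / 2 * (2 + i.+1%:R^-1 * i.+1%:R^-1)) / 4 + i.+1%:R^-1.

Lemma cvg_energy_error (R : realType) : energy_error R i @[i --> \oo] --> (0 : R).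
Proof.
have k0 := fibre_ratio_gt0 R; set k := fibre_ratio R in k0.
have pi0 : 0 < pi :> R by exact: pi_gt0.
have sp : 0 < Num.sqrt pi :> R by rewrite sqrtr_gt0.
(* At [rho = k] the term [rho * sqrt pi / 4] equals [2 / 3], which is the constant appearing
   here. *)
have CE : C_S R = 2 / 3 - 2 / 3 * ln k.
  have -> : C_S R = 1 / 3 * (2 + ln (k ^+ 2)^-1).
    rewrite /C_S; congr (_ * (_ + ln _)).
    rewrite /k /fibre_ratio expr_div_n exprMn sqr_sqrtr ?ltW // invf_div.
    by rewrite !expr2 -!natrM.
  by rewrite lnV ?posrE ?exprn_gt0 // lnXn // -mulr_natl; lra.
have -> : 0 = - (2 / 3 * ln k) - C_S R + k * Num.sqrt (pi / 2 * (2 + 0 * 0)) / 4 + 0.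
  rewrite mulr0 !addr0 mulrAC divfK // CE.
  have -> : k * Num.sqrt pi = 8 / 3.
    by rewrite /k /fibre_ratio invfM mulrA divfK ?gt_eqF.
  lra.
have H := @cvg_harmonic R.
have Hr := @cvg_fibre_size R.
apply: cvgD => //; apply: cvgD.
  apply: cvgB; last exact: cvg_cst.
  apply: cvgN; apply: cvgM; first exact: cvg_cst.
  exact: (continuous_cvg _ (continuous_ln k0) Hr).
apply: cvgM; last exact: cvg_cst.
apply: cvgM => //.
apply: (continuous_cvg _ (@sqrt_continuous R _)).
apply: cvgM; first exact: cvg_cst.
apply: cvgD; first exact: cvg_cst.
exact: cvgM.
Qed.

Lemma inv_cbr_le (R : realType) (s : R) m : 0 < s -> m%:R = s ^+ 2 ->
  (cbr m)^-1 <= s * Num.sqrt (pi / 2 * (2 + s^-1 * s^-1)).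
Proof.
move=> s0 ms; have c0 := cbr_gt0 R m; have pi0 : 0 < pi :> R := pi_gt0 R.
have t0 : 0 < s^-1 by rewrite invr_gt0.
have W0 : 0 < pi / 2 * (2 + s^-1 * s^-1).
  by rewrite mulr_gt0 ?divr_gt0 // addr_gt0 // mulr_gt0.
rewrite -ler_sqr ?nnegrE ?invr_ge0 ?mulr_ge0 ?sqrtr_ge0 ?(ltW c0) ?(ltW s0) //.
rewrite exprMn (sqr_sqrtr (ltW W0)) exprVn invf_ple ?posrE ?exprn_gt0 //; last first.
  by rewrite mulr_gt0 // exprn_gt0.
have -> : s ^+ 2 * (pi / 2 * (2 + s^-1 * s^-1)) = pi / 2 * (m.*2.+1)%:R.
  rewrite [(m.*2.+1)%:R]mulrSr natr_double ms; have := mulfV (lt0r_neq0 s0); set t := s^-1 => st.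
  transitivity (pi / 2 * (2 * s ^+ 2 + (s * t) * (s * t))); first by lra.
  by rewrite st; lra.
rewrite invfM invf_div ler_pdivrMr ?ltr0n // [leRHS]mulrC.
exact: wallis_le.
Qed.

(** With [s = i.+1] and [n = s^2 r], the identity [ln r = (1/3) ln n + (2/3) ln (r / s)] accounts
    for the logarithms; [inv_cbr_le] and [1 <= s r] do the rest. *)
Lemma low_energy_error (R : realType) M i (n := (M.+1 * fibre_size R i)%N) :
  M.+1 = (i.+1 ^ 2)%N ->
  - (n%:R ^+ 2 / 4) - n%:R * ln (fibre_size R i)%:R +
    (fibre_size R i)%:R ^+ 2 / (4 * cbr M.+1) + 1 <=
  - (n%:R ^+ 2 / 4) - 1 / 3 * n%:R * ln n%:R + C_S R * n%:R + n%:R * energy_error R i :> R.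
Proof.
move=> ME.
have r1 : 1 <= (fibre_size R i)%:R :> R by rewrite ler1n.
have s1 : 1 <= i.+1%:R :> R by rewrite ler1n.
have ms : M.+1%:R = i.+1%:R ^+ 2 :> R by rewrite ME natrX.
have nE : n%:R = i.+1%:R ^+ 2 * (fibre_size R i)%:R :> R by rewrite /n natrM ms.
rewrite /energy_error nE {n nE}.
move: (fibre_size R i)%:R r1 (i.+1%:R) s1 ms => r r1 s s1 ms.
have r0 : 0 < r by lra.
have s0 : 0 < s by lra.
have cW := inv_cbr_le s0 ms; move: (Num.sqrt _) cW => W cW.
have -> : r ^+ 2 / (4 * cbr M.+1) = r ^+ 2 * (cbr M.+1)^-1 / 4.
  by rewrite invfM; lra.
move: ((cbr M.+1)^-1) cW => c cW.
rewrite lnM ?posrE ?exprn_gt0 // lnXn // ln_div ?posrE // mulr2n.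
move: (ln r) (ln s) (C_S R) => lr ls C.
have := mulfV (lt0r_neq0 s0); set t := s^-1 => st.
have -> : s ^+ 2 * r * (- (2 / 3 * (lr - ls)) - C + r * t * W / 4 + t) =
  s ^+ 2 * r * (- (2 / 3 * (lr - ls)) - C) + (s * t) * (r ^+ 2 * (s * W) / 4) + (s * t) * (s * r).
  by lra.
rewrite st !mul1r.
have H1 : r ^+ 2 * c <= r ^+ 2 * (s * W) by rewrite ler_wpM2l ?sqr_ge0.
have H2 : 1 <= s * r by rewrite mulr_ege1.
lra.
Qed.

Theorem corollary1p4 (R : realType) :
  exists n : nat -> nat,
    (forall i, (0 < n i)%N) /\
    n @ \oo --> \oo /\
    exists m r : nat -> R,
      (forall i, is_min_log_energy (n i) (m i)) /\
      r =o_\oo (fun i => (n i)%:R : R) /\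
      forall i, m i <= - ((n i)%:R ^+ 2 / 4) - 1 / 3 * (n i)%:R * ln (n i)%:R
                       + C_S R * (n i)%:R + r i.
Proof.
(* A square number of fibres makes [sqrt m] an integer; the predecessor appears because [M] is the
   degree of the monomials, one less than [m]. *)
pose M i := (i.+1 ^ 2).-1.
have ME i : (M i).+1 = (i.+1 ^ 2)%N by rewrite /M prednK // expn_gt0.
pose n i := ((M i).+1 * fibre_size R i)%N.
have n0 i : (0 < n i)%N by rewrite muln_gt0.
have nge i : (i.+1 <= n i)%N.
  by rewrite /n ME (leq_trans (leq_pexp2l _ (_ : 1 <= 2)%N)) // leq_pmulr.
exists n; split=> //; split.
  move=> P [K _ KP]; exists K => // i /= Ki; apply: KP => /=.
  exact: leq_trans Ki (leq_trans (leqnSn _) (nge i)).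
have H i : exists m : R, is_min_log_energy (n i) m /\
    m <= - ((n i)%:R ^+ 2 / 4) - 1 / 3 * (n i)%:R * ln (n i)%:R
                       + C_S R * (n i)%:R + (n i)%:R * energy_error R i.
  have [x xS xE] := @exists_low_log_energy R (M i) (fibre_size R i) isT.
  have [m mmin] := min_log_energy_exists xS.
  exists m; split=> //; have [_ mlb] := mmin.
  have {mlb} mx : m <= log_energy x by apply: mlb; exists x.
  apply: (le_trans mx); apply: (le_trans xE).
  exact: low_energy_error (ME i).
have [m mH] := choice H.
exists m, (fun i => (n i)%:R * energy_error R i); split; first by move=> i; have [] := mH i.
split; last by move=> i; have [] := mH i.
apply/eqoP => _/posnumP[e].
have := @cvg_energy_error R => /cvgrPdist_le /(_ e%:num (gt0 _)).
apply: filterS => i; rewrite sub0r normrN => He.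
by rewrite normrM mulrC ler_wpM2r.
Qed.
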